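(* Consider the two-tubes IPM equations (defined in the context). (A) There exist $l_0,\delta>0$ such that for all $v\in(-\tfrac14-\delta,-\tfrac14+\delta)$ and $l\in(0,l_0)$ there exists a traveling wave solution $(c_1,c_2,u_1,u_2,q)(y-vt)$ with speed $v$ satisfying $(c_1,c_2,u_1,u_2,q)(-\infty)=(-1,-1,0,0,0)$ and connecting $$(-1,-1,0,0,0)\ \text{ to }\ \Big(c_1^*,c_2^*,\tfrac{c_2^*-c_1^*}{2},\tfrac{c_1^*-c_2^*}{2},0\Big),$$ where $c_i^*=c_i^*(v,l)$ depend continuously on $(v,l)\in(-\tfrac14-\delta,-\tfrac14+\delta)\times(0,l_0)$ and, for fixed $v$, $c_1^*(v,l)\to-6v-1$ and $c_2^*(v,l)\to-2v-1$ as $l\to0$. (B) There exist $l_0,\delta>0$ such that for all $v\in(\tfrac14-\delta,\tfrac14+\delta)$ and $l\in(0,l_0)$ there exists a traveling wave solution $(c_1,c_2,u_1,u_2,q)(y-vt)$ with speed $v$ satisfying $(c_1,c_2,u_1,u_2,q)(+\infty)=(1,1,0,0,0)$ and connecting $$\Big(c_1^{**},c_2^{**},\tfrac{c_2^{**}-c_1^{**}}{2},\tfrac{c_1^{**}-c_2^{**}}{2},0\Big)\ \text{ to }\ (1,1,0,0,0),$$ where $c_i^{**}=c_i^{**}(v,l)$ depend continuously on $(v,l)\in(\tfrac14-\delta,\tfrac14+\delta)\times(0,l_0)$ and, for fixed $v$, $c_1^{**}(v,l)\to-2v+1$ and $c_2^{**}(v,l)\to-6v+1$ as $l\to0$.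
   Context: Two-tubes IPM equations with parameter $l>0$: unknowns $c_1,c_2,u_1,u_2,q$, real functions of $(t,y)\in[0,\infty)\times\mathbb{R}$, satisfying $$\partial_t c_1+\partial_y(u_1c_1)-\partial_{yy}c_1=-f,\qquad \partial_t c_2+\partial_y(u_2c_2)-\partial_{yy}c_2=f,$$ $$\partial_y q=u_1-u_2+c_1-c_2,\qquad \partial_y u_1=\frac{q}{l^2},\qquad u_1+u_2=0,$$ where, with $u_T:=-q/l$, $f=\frac{u_T}{l}c_1$ if $u_T\ge0$ and $f=\frac{u_T}{l}c_2$ if $u_T\le0$. A traveling wave with speed $v$ connecting $g_-,g_+\in\mathbb{R}^5$ is a solution of the form $(c_1,c_2,u_1,u_2,q)(t,y)=\tilde g(y-vt)$ with $\tilde g:\mathbb{R}\to\mathbb{R}^5$ continuous (and smooth enough to solve the equations classically), $\tilde g(-\infty)=g_-$, $\tilde g(+\infty)=g_+$. (In the paper, $\pm\tfrac14$ are the speeds $v_1^*,v_2^*$ of the traveling waves of the associated TFE model.) *)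

(* Defs.v *)
From Stdlib Require Import Reals.
From Coquelicot Require Import Coquelicot.
Open Scope R_scope.

Definition ex_dt (F : R -> R -> R) (t y : R) : Prop := ex_derive (fun s => F s y) t.
Definition ex_dy (F : R -> R -> R) (t y : R) : Prop := ex_derive (fun z => F t z) y.
Definition dt (F : R -> R -> R) (t y : R) : R := Derive (fun s => F s y) t.
Definition dy (F : R -> R -> R) (t y : R) : R := Derive (fun z => F t z) y.

Definition uT (l q : R) : R := - q / l.
Definition fexch (l c1 c2 q : R) : R :=
  if Rle_dec 0 (uT l q) then uT l q / l * c1 else uT l q / l * c2.

Definition IPM_solution (l : R) (c1 c2 u1 u2 q : R -> R -> R) : Prop :=
  forall t y : R, 0 <= t ->
    (* regularity needed for the equations to make sense classically *)
    ex_dt c1 t y /\ ex_dt c2 t y /\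
    ex_dy c1 t y /\ ex_dy c2 t y /\
    ex_dy (dy c1) t y /\ ex_dy (dy c2) t y /\
    ex_dy (fun s z => u1 s z * c1 s z) t y /\
    ex_dy (fun s z => u2 s z * c2 s z) t y /\
    ex_dy q t y /\ ex_dy u1 t y /\
    dt c1 t y + dy (fun s z => u1 s z * c1 s z) t y - dy (dy c1) t y
      = - fexch l (c1 t y) (c2 t y) (q t y) /\
    dt c2 t y + dy (fun s z => u2 s z * c2 s z) t y - dy (dy c2) t y
      = fexch l (c1 t y) (c2 t y) (q t y) /\
    dy q t y = u1 t y - u2 t y + c1 t y - c2 t y /\
    dy u1 t y = q t y / l ^ 2 /\
    u1 t y + u2 t y = 0.

Definition traveling_wave (l v : R) (a1 a2 a3 a4 a5 b1 b2 b3 b4 b5 : R) : Prop :=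
  exists g1 g2 g3 g4 g5 : R -> R,
    (forall x, continuous g1 x) /\ (forall x, continuous g2 x) /\
    (forall x, continuous g3 x) /\ (forall x, continuous g4 x) /\
    (forall x, continuous g5 x) /\
    is_lim g1 m_infty a1 /\ is_lim g2 m_infty a2 /\ is_lim g3 m_infty a3 /\
    is_lim g4 m_infty a4 /\ is_lim g5 m_infty a5 /\
    is_lim g1 p_infty b1 /\ is_lim g2 p_infty b2 /\ is_lim g3 p_infty b3 /\
    is_lim g4 p_infty b4 /\ is_lim g5 p_infty b5 /\
    IPM_solution l (fun t y => g1 (y - v * t)) (fun t y => g2 (y - v * t))
                   (fun t y => g3 (y - v * t)) (fun t y => g4 (y - v * t))
                   (fun t y => g5 (y - v * t)).

(* Main.v *)
(* Put V = - v > 0, kappa = sqrt 2 / (l V) and c1 = -1 + V C, c1 + c2 = -2 + V S, u1 = V U, all taken at V (y - v t).  As long as q <= 0 the wave equations integrate to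
     C'' = (1 + U) C',   S' = S + U (2 C - S),   U'' = kappa^2 (U - G)   with G = S / 2 - C,
   so only kappa is left, and l -> 0 means kappa -> oo.  For U = G the explicit orbit is C = 6 w, S = 8 w, U = -2 w with w' = w (1 - w).  In the unknowns S - 4 C / 3, C' - C + C^2 / 6 and C - 6 w the linearization at this orbit is triangular up to a loop of gain < 1 in norms weighted by powers of w, so for large kappa the wave is the fixed point of a contraction, and its end state is Lipschitz in kappa.  The sign of q follows from a second contraction: P = C', Y = S' and X = - U' satisfy a positive linear system whose solutions stay close to Y = 4 P / 3, X = P / 3.  Part (B) is the image of part (A) under (c1, c2, u1, q)(x) -> (-c2, -c1, u1, -q)(-x), v -> -v. *)

Require Import Defs.
From Stdlib Require Import Reals.
From Coquelicot Require Import Coquelicot.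
From Stdlib Require Import Lra.
Open Scope R_scope.

(** The constants 6, 8 and -2 come from the ansatz [S = alpha C] in the limit [U = G]. The equation
    for [C] then integrates to [C' = C + (alpha / 2 - 1) C^2 / 2], and for [alpha <> 2] the equation
    for [S] agrees with it exactly when [alpha / 2 = 2 - alpha]. So [alpha = 4 / 3], [U = - C / 3]
    and [C' = C - C^2 / 6]. Both relations are invariant in the limit, hence the deviations
    [S - 4 C / 3] and [C' - C + C^2 / 6] are driven only by each other and by [U - G]. Two facts
    shape the norms. Orbits come in translates, so the linearization has the kernel [w (1 - w)];
    weights of order [w^2] at minus infinity exclude it and fix the phase. At plus infinity the end
    state is not known in advance, so the weights of [C] and [S] cannot vanish there, and
    convergence to an end state has to come from the monotonicity of the profile. *)

(** * Monotone functions and limits under reflection *)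

Lemma derive_nonneg_le (f f' : R -> R) :
  (forall x, is_derive f x (f' x)) -> (forall x, 0 <= f' x) ->
  forall x y, x <= y -> f x <= f y.
Proof.
intros Hd Hp x y Hxy.
destruct (MVT_gen f x y f') as [c [_ Hc]].
- intros z _; apply Hd.
- intros z _; apply continuity_pt_filterlim, (ex_derive_continuous f); eexists; apply Hd.
- specialize (Hp c); nra.
Qed.

Lemma is_lim_monotone_p (f : R -> R) (M : R) :
  (forall x y, x <= y -> f x <= f y) -> (forall x, f x <= M) ->
  exists l : R, is_lim f p_infty l.
Proof.
intros Hm HM.
destruct (completeness (fun r => exists x, r = f x)) as [l [Hub Hl]].
- exists M; intros r [x ->]; apply HM.
- exists (f 0), 0; reflexivity.
- exists l; apply is_lim_spec; intros eps; simpl.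
  assert (Hx : exists x, l - eps < f x).
  { apply Classical_Prop.NNPP; intros Hn.
    assert (l <= l - eps).
    { apply Hl; intros r [x ->]. apply Rnot_lt_le; intros Hlt; apply Hn; now exists x. }
    destruct eps as [e He]; simpl in *; lra. }
  destruct Hx as [x0 Hx0]; exists x0; intros x Hx.
  assert (f x <= l) by (apply Hub; now exists x).
  assert (f x0 <= f x) by (apply Hm; lra).
  apply Rabs_def1; destruct eps; simpl in *; lra.
Qed.

Lemma is_lim_opp_p_m (f : R -> R) (l : Rbar) :
  is_lim (fun x => f (- x)) p_infty l -> is_lim f m_infty l.
Proof.
intros H.
apply (is_lim_ext (fun x => f (- - x))); [intros; f_equal; ring|].
apply (is_lim_comp (fun x => f (- x)) Ropp m_infty l p_infty).
- exact H.
- apply (is_lim_opp (fun x => x) m_infty m_infty), is_lim_id.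
- exists 0; intros; discriminate.
Qed.

Lemma is_lim_opp_m_p (f : R -> R) (l : Rbar) :
  is_lim (fun x => f (- x)) m_infty l -> is_lim f p_infty l.
Proof.
intros H.
apply (is_lim_ext (fun x => f (- - x))); [intros; f_equal; ring|].
apply (is_lim_comp (fun x => f (- x)) Ropp p_infty l m_infty).
- exact H.
- apply (is_lim_opp (fun x => x) p_infty p_infty), is_lim_id.
- exists 0; intros; discriminate.
Qed.

(** * First-order linear equations integrated from one end of the line *)

Definition tail (fwd : bool) : Rbar := if fwd then m_infty else p_infty.
Definition sgn (fwd : bool) : R := if fwd then 1 else -1.

(* W is a supersolution of y' = a y + f, integrated from [tail fwd]: a forcing |f| <= M gap yields |y| <= M W. The last condition excludes the homogeneous solution m. *)
Definition admissible (fwd : bool) (a m W gap : R -> R) : Prop :=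
  (forall x, 0 < m x /\ is_derive m x (a x * m x)) /\
  (forall x, 0 < W x /\ exists dW, is_derive W x dW /\
     gap x <= sgn fwd * (dW - a x * W x)) /\
  is_lim (fun x => W x / m x) (tail fwd) 0.

Lemma tail_sign (fwd : bool) (f : R -> R) :
  (forall x y, x <= y -> f x <= f y) -> is_lim f (tail fwd) 0 ->
  forall x, 0 <= sgn fwd * f x.
Proof.
intros Hm Hl x; destruct fwd; simpl in *.
- assert (H : Rbar_le 0 (f x)).
  { apply (is_lim_le_loc f (fun _ => f x) m_infty); [|exact Hl|apply is_lim_const].
    exists x; intros y Hy; apply Hm; lra. }
  simpl in H; lra.
- assert (H : Rbar_le (f x) 0).
  { apply (is_lim_le_loc (fun _ => f x) f p_infty); [|apply is_lim_const|exact Hl].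
    exists x; intros y Hy; apply Hm; lra. }
  simpl in H; lra.
Qed.


(** [W / m] has derivative [(W' - a W) / m], which up to orientation dominates [gap / m], while
    [F' = f / m]. So the signed [M W / m] outweighs [F] with either sign, and no integral has to be
    estimated. *)
Lemma ratio_monotone fwd a m W gap (M : R) (F f : R -> R) (s : R) :
  admissible fwd a m W gap -> 0 <= M -> Rabs s <= 1 ->
  (forall x, is_derive F x (f x / m x)) -> (forall x, Rabs (f x) <= M * gap x) ->
  forall x y, x <= y ->
    sgn fwd * (M * (W x / m x)) + s * F x <= sgn fwd * (M * (W y / m y)) + s * F y.
Proof.
intros [Hm [HW _]] HM Hs HF Hf x y Hxy.
pose (dW := fun z => Derive W z).
assert (HdW : forall z, is_derive W z (dW z) /\ gap z <= sgn fwd * (dW z - a z * W z)).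
{ intros z; destruct (HW z) as [_ [d [Hd Hg]]].
  unfold dW; rewrite (is_derive_unique _ _ _ Hd); now split. }
apply (derive_nonneg_le
  (fun z => sgn fwd * (M * (W z / m z)) + s * F z)
  (fun z => (M * (sgn fwd * (dW z - a z * W z)) + s * f z) / m z)); [| |exact Hxy].
- intros z; destruct (Hm z) as [Hmz Hdm]; destruct (HdW z) as [Hd _].
  auto_derive.
  + repeat split; try (eexists; eassumption); try (eexists; apply HF); lra.
  + rewrite (is_derive_unique (fun x : R => W x) _ _ Hd), (is_derive_unique (fun x : R => m x) _ _ Hdm),
      (is_derive_unique (fun x : R => F x) _ _ (HF z)). field; lra.
- intros z; destruct (Hm z) as [Hmz _]; destruct (HdW z) as [_ Hg].
  apply Rmult_le_pos; [|left; apply Rinv_0_lt_compat; lra].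
  assert (Rabs (s * f z) <= M * gap z).
  { rewrite Rabs_mult. specialize (Hf z). pose proof (Rabs_pos (f z)). nra. }
  assert (M * gap z <= M * (sgn fwd * (dW z - a z * W z))) by (apply Rmult_le_compat_l; lra).
  pose proof (Rle_abs (- (s * f z))) as H1; rewrite Rabs_Ropp in H1. lra.
Qed.

(** A monotone function that vanishes at the tail has a fixed sign; [s = 1] and [s = -1] give the
    two halves of the bound. *)
Lemma ratio_bound fwd a m W gap (M : R) (F f : R -> R) :
  admissible fwd a m W gap -> 0 <= M ->
  (forall x, is_derive F x (f x / m x)) -> (forall x, Rabs (f x) <= M * gap x) ->
  is_lim F (tail fwd) 0 ->
  forall x, Rabs (m x * F x) <= M * W x.
Proof.
intros Ha HM HF Hf Hl x.
assert (Hs : forall s, Rabs s <= 1 -> 0 <= sgn fwd * (sgn fwd * (M * (W x / m x)) + s * F x)).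
{ intros s Hs.
  apply (tail_sign fwd (fun x => sgn fwd * (M * (W x / m x)) + s * F x)).
  - now apply (ratio_monotone fwd a m W gap M F f s).
  - destruct Ha as [_ [_ H0]].
    replace (Finite 0) with (Finite (sgn fwd * (M * 0) + s * 0)) by (f_equal; ring).
    apply is_lim_plus'.
    + apply (is_lim_scal_l _ (sgn fwd) _ (Finite (M * 0))).
      now apply (is_lim_scal_l _ M _ (Finite 0)).
    + now apply (is_lim_scal_l _ s _ (Finite 0)). }
destruct Ha as [Hm _]; destruct (Hm x) as [Hmx _].
assert (HWm : W x = m x * (W x / m x)) by (field; lra).
pose proof (Hs 1) as H1; pose proof (Hs (-1)) as H2.
rewrite Rabs_R1 in H1; rewrite Rabs_left in H2 by lra.
assert (Hss : sgn fwd * sgn fwd = 1) by (destruct fwd; simpl; ring).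
assert (Hb : Rabs (F x) <= M * (W x / m x)).
{ specialize (H1 (Rle_refl _)); specialize (H2 ltac:(lra)).
  destruct fwd; simpl in *; apply Rabs_le; lra. }
rewrite Rabs_mult, (Rabs_right (m x)), HWm by lra. nra.
Qed.

(** The a priori bound with [M'] forces [y / m] to vanish at the tail and leaves no trace in the
    conclusion. Any crude bound is thus improved to one governed by the forcing alone, which drives
    the uniqueness and bootstrap arguments below. *)
Lemma comparison fwd a m W gap (M M' : R) (y f : R -> R) :
  admissible fwd a m W gap -> 0 <= M ->
  (forall x, is_derive y x (a x * y x + f x)) ->
  (forall x, Rabs (f x) <= M * gap x) -> (forall x, Rabs (y x) <= M' * W x) ->
  forall x, Rabs (y x) <= M * W x.
Proof.
intros Ha HM Hy Hf Hb x.
pose proof Ha as [Hm [HW H0]].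
destruct (Hm x) as [Hmx _].
replace (y x) with (m x * (y x / m x)) by (field; lra).
apply (ratio_bound fwd a m W gap M (fun x => y x / m x) f Ha HM); [|exact Hf|].
- intros z; destruct (Hm z) as [Hmz Hdm].
  auto_derive.
  + repeat split; try (eexists; eassumption); try (eexists; apply Hy); lra.
  + rewrite (is_derive_unique (fun x : R => m x) _ _ Hdm), (is_derive_unique (fun x : R => y x) _ _ (Hy z)). field; lra.
- assert (HL : forall s, is_lim (fun x => s * (W x / m x)) (tail fwd) 0).
  { intros s. replace (Finite 0) with (Finite (s * 0)) by (f_equal; ring).
    now apply (is_lim_scal_l _ s _ (Finite 0)). }
  apply (is_lim_le_le_loc (fun x => (- M') * (W x / m x)) (fun x => M' * (W x / m x)));
    [|apply HL|apply HL].
  assert (HA : forall z, - M' * (W z / m z) <= y z / m z <= M' * (W z / m z)).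
  { intros z; destruct (Hm z) as [Hmz _]. pose proof (Rinv_0_lt_compat _ Hmz).
    specialize (Hb z); apply Rabs_le_between in Hb. unfold Rdiv.
    split; nra. }
  destruct fwd; simpl; exists 0; intros; apply HA.
Qed.

(** Variation of constants with the integral started at the tail. The improper integral is written
    as an integral from 0 minus its limit; [Lim] is total, so the value has meaning only once
    convergence is known, as in [solve_spec]. *)
Definition solve (fwd : bool) (m f : R -> R) (x : R) : R :=
  m x * (RInt (fun z => f z / m z) 0 x
         - real (Lim (fun x => RInt (fun z => f z / m z) 0 x) (tail fwd))).

Lemma is_lim_monotone_tail fwd (f : R -> R) (M : R) :
  (forall x y, x <= y -> f x <= f y) ->
  (forall x, sgn fwd * x <= 0 -> - M <= sgn fwd * f x) ->
  exists l : R, is_lim f (tail fwd) l.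
Proof.
intros Hm HM; destruct fwd; simpl in *.
- destruct (is_lim_monotone_p (fun x => - f (- x)) M) as [l Hl].
  + intros x y Hxy; apply Ropp_le_contravar, Hm; lra.
  + intros x. destruct (Rle_dec 0 x).
    * specialize (HM (- x)); lra.
    * assert (f 0 <= f (- x)) by (apply Hm; lra). specialize (HM 0); lra.
  + exists (- l); apply is_lim_opp_p_m.
    apply (is_lim_ext (fun x => - - f (- x))); [intros; ring|].
    now apply (is_lim_opp (fun x => - f (- x)) p_infty l).
- apply (is_lim_monotone_p f M Hm). intros x. destruct (Rle_dec 0 x).
  + specialize (HM x); lra.
  + assert (f x <= f 0) by (apply Hm; lra). specialize (HM 0); lra.
Qed.

(** The primitive of [f / m] converges at the tail because adding the signed [M W / m] makes it
    monotone, and the added term tends to 0 there. *)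
Lemma solve_spec fwd a m W gap (M : R) (f : R -> R) :
  admissible fwd a m W gap -> 0 <= M ->
  (forall x, continuous f x) -> (forall x, Rabs (f x) <= M * gap x) ->
  forall x, is_derive (solve fwd m f) x (a x * solve fwd m f x + f x) /\
            Rabs (solve fwd m f x) <= M * W x.
Proof.
intros Ha HM Hc Hf.
pose proof Ha as [Hm [HW H0]].
set (G := fun x => RInt (fun z => f z / m z) 0 x).
assert (Hcm : forall z, continuous (fun z => f z / m z) z).
{ intros z; destruct (Hm z) as [Hmz Hdm].
  apply (continuous_mult f (fun z => / m z)); [apply Hc|].
  apply continuous_Rinv_comp; [|lra].
  apply (ex_derive_continuous m); eexists; apply Hdm. }
assert (HG : forall z, is_derive G z (f z / m z)).
{ intros z. apply (is_derive_RInt (fun z => f z / m z) G 0 z).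
  - apply filter_forall; intros y; apply (RInt_correct (fun z => f z / m z)).
    apply (ex_RInt_continuous (fun z => f z / m z)); intros; apply Hcm.
  - apply Hcm. }
assert (HG0 : G 0 = 0) by (unfold G; rewrite RInt_point; reflexivity).
pose (B := fun x => M * (W x / m x)).
assert (HBl : is_lim B (tail fwd) 0).
{ unfold B; replace (Finite 0) with (Finite (M * 0)) by (f_equal; ring).
  now apply (is_lim_scal_l _ M _ (Finite 0)). }
assert (HB0 : forall x, 0 <= B x).
{ intros z; destruct (Hm z) as [Hmz _]; destruct (HW z) as [HWz _]; unfold B.
  apply Rmult_le_pos; [lra|]. left; now apply Rdiv_lt_0_compat. }
assert (Hmon : forall s, Rabs s <= 1 -> forall x y, x <= y ->
   sgn fwd * B x + s * G x <= sgn fwd * B y + s * G y).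
{ intros s Hs; now apply (ratio_monotone fwd a m W gap M G f s). }
destruct (is_lim_monotone_tail fwd (fun x => sgn fwd * B x + 1 * G x) (B 0)) as [l Hl].
{ apply Hmon; rewrite Rabs_R1; lra. }
(* The bound towards the tail comes from the monotonicity for [s = -1], compared with the point 0,
   where [G] vanishes. *)
{ intros x Hx.
  assert (Hn : Rabs (-1) <= 1) by (rewrite Rabs_left; lra).
  pose proof (HB0 x); pose proof (HB0 0).
  destruct fwd; simpl in *.
  - pose proof (Hmon (-1) Hn x 0 ltac:(lra)). rewrite HG0 in *. lra.
  - pose proof (Hmon (-1) Hn 0 x ltac:(lra)). rewrite HG0 in *. lra. }
assert (HGl : is_lim G (tail fwd) l).
{ apply (is_lim_ext (fun x => (sgn fwd * B x + 1 * G x) + (- sgn fwd) * B x)); [intros; ring|].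
  replace (Finite l) with (Finite (l + (- sgn fwd) * 0)) by (f_equal; ring).
  apply is_lim_plus'; [exact Hl|].
  now apply (is_lim_scal_l _ (- sgn fwd) _ (Finite 0)). }
assert (HS : forall x, solve fwd m f x = m x * (G x - l)).
{ intros z; unfold solve; fold G. now rewrite (is_lim_unique _ _ _ HGl). }
intros x; split.
- apply (is_derive_ext (fun x => m x * (G x - l))); [intros; symmetry; apply HS|].
  rewrite HS. destruct (Hm x) as [Hmx Hdm].
  auto_derive.
  + repeat split; try (eexists; eassumption); eexists; apply HG.
  + rewrite (is_derive_unique (fun x : R => m x) _ _ Hdm), (is_derive_unique (fun x : R => G x) _ _ (HG x)). field; lra.
- rewrite HS. apply (ratio_bound fwd a m W gap M (fun x => G x - l) f Ha HM); [|exact Hf|].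
  + intros z. auto_derive; [eexists; apply HG|].
    rewrite (is_derive_unique (fun x : R => G x) _ _ (HG z)). ring.
  + replace (Finite 0) with (Finite (l - l)) by (f_equal; ring).
    apply is_lim_minus'; [exact HGl|apply is_lim_const].
Qed.

Lemma is_derive_continuous (f : R -> R) (x l : R) : is_derive f x l -> continuous f x.
Proof. intros H; apply (ex_derive_continuous f); eexists; apply H. Qed.

Lemma comparison_minus fwd a m W gap (M M' : R) (y1 y2 f1 f2 : R -> R) :
  admissible fwd a m W gap -> 0 <= M ->
  (forall x, is_derive y1 x (a x * y1 x + f1 x)) ->
  (forall x, is_derive y2 x (a x * y2 x + f2 x)) ->
  (forall x, Rabs (f1 x - f2 x) <= M * gap x) ->
  (forall x, Rabs (y1 x) <= M' * W x) -> (forall x, Rabs (y2 x) <= M' * W x) ->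
  forall x, Rabs (y1 x - y2 x) <= M * W x.
Proof.
intros Ha HM H1 H2 Hf Hb1 Hb2.
apply (comparison fwd a m W gap M (2 * M') (fun x => y1 x - y2 x) (fun x => f1 x - f2 x)); auto.
- intros x. replace (_ + _) with ((a x * y1 x + f1 x) - (a x * y2 x + f2 x)) by ring.
  now apply (is_derive_minus y1 y2 x).
- intros x. specialize (Hb1 x); specialize (Hb2 x).
  apply Rabs_le_between in Hb1, Hb2; apply Rabs_le; lra.
Qed.

(** * Fixed points of contractive systems *)

(** With [k = K / (1 - rho)] the sequences [u n - k rho^n] and [u n + k rho^n] are adjacent, which
    gives the limit and the rate at once. *)
Lemma geometric_limit (u : nat -> R) (K rho : R) :
  0 < rho < 1 -> 0 <= K -> (forall n, Rabs (u (S n) - u n) <= K * rho ^ n) ->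
  forall n, Rabs (u n - real (Lim_seq u)) <= K / (1 - rho) * rho ^ n.
Proof.
intros Hr HK Hu n.
set (k := K / (1 - rho)).
assert (Hk : k * (1 - rho) = K) by (unfold k; field; lra).
assert (Hz : is_lim_seq (fun n => k * rho ^ n) 0).
{ replace (Finite 0) with (Rbar_mult k 0) by (simpl; f_equal; ring).
  apply is_lim_seq_scal_l, is_lim_seq_geom. rewrite Rabs_right; lra. }
set (lo := fun n => u n - k * rho ^ n); set (up := fun n => u n + k * rho ^ n).
assert (Hlo : forall n, lo n <= lo (S n)).
{ intros p; unfold lo; specialize (Hu p); apply Rabs_le_between in Hu; simpl.
  rewrite <- Hk in Hu. lra. }
assert (Hup : forall n, up (S n) <= up n).
{ intros p; unfold up; specialize (Hu p); apply Rabs_le_between in Hu; simpl.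
  rewrite <- Hk in Hu. lra. }
destruct (ex_lim_seq_adj lo up Hlo Hup) as [Elo [Eup Heq]].
{ apply (is_lim_seq_ext (fun n => 2 * (k * rho ^ n))); [intros; unfold lo, up; ring|].
  replace (Finite 0) with (Rbar_mult 2 0) by (simpl; f_equal; ring).
  now apply is_lim_seq_scal_l. }
destruct Elo as [L HL].
assert (HU : is_lim_seq u L).
{ apply (is_lim_seq_ext (fun n => lo n + k * rho ^ n)); [intros; unfold lo; ring|].
  replace (Finite L) with (Finite (L + 0)) by (f_equal; ring).
  now apply is_lim_seq_plus'. }
assert (HU' : is_lim_seq up L).
{ unfold up. replace (Finite L) with (Finite (L + 0)) by (f_equal; ring).
  now apply is_lim_seq_plus'. }
rewrite (is_lim_seq_unique _ _ HU); simpl.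
pose proof (is_lim_seq_incr_compare lo L HL Hlo n).
pose proof (is_lim_seq_decr_compare up L HU' Hup n).
unfold lo, up in *. apply Rabs_le. lra.
Qed.

Lemma geometric_small (C rho : R) : 0 < rho < 1 -> is_lim_seq (fun n => C * rho ^ n) 0.
Proof.
intros Hr. replace (Finite 0) with (Rbar_mult C 0) by (simpl; f_equal; ring).
apply is_lim_seq_scal_l, is_lim_seq_geom. rewrite Rabs_right; lra.
Qed.

Lemma Rabs_le_geometric (y b C rho : R) :
  0 < rho < 1 -> (forall n, Rabs y <= b + C * rho ^ n) -> Rabs y <= b.
Proof.
intros Hr H.
assert (Hl : Rbar_le (Rabs y) (b + 0)).
{ apply (is_lim_seq_le (fun _ => Rabs y) (fun n => b + C * rho ^ n)); [apply H|apply is_lim_seq_const|].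
  apply is_lim_seq_plus'; [apply is_lim_seq_const|now apply geometric_small]. }
simpl in Hl; lra.
Qed.

Lemma continuous_geometric_limit (u : nat -> R -> R) (g W : R -> R) (C rho : R) :
  0 < rho < 1 -> 0 < C -> (forall x, continuous W x) -> (forall n x, continuous (u n) x) ->
  (forall n x, Rabs (u n x - g x) <= C * rho ^ n * W x) -> forall x, continuous g x.
Proof.
intros Hr HC HW Hu Hb x.
apply filterlim_locally; intros eps.
assert (He3 : 0 < eps / 3) by (destruct eps; simpl; lra).
assert (HWx : 0 < Rabs (W x) + 1) by (pose proof (Rabs_pos (W x)); lra).
pose proof (geometric_small (C * (Rabs (W x) + 1)) rho Hr) as Hg.
apply is_lim_seq_spec in Hg. destruct (Hg (mkposreal _ He3)) as [n Hn].
specialize (Hn n (le_n _)); simpl in Hn.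
assert (Hr0 : 0 < rho ^ n) by (apply pow_lt; lra).
rewrite Rminus_0_r, Rabs_right in Hn by (apply Rle_ge, Rmult_le_pos; nra).
pose proof (proj1 (filterlim_locally _ _) (HW x) (mkposreal 1 Rlt_0_1)) as H1.
pose proof (proj1 (filterlim_locally _ _) (Hu n x) (mkposreal _ He3)) as H2.
generalize (filter_and _ _ H1 H2); apply filter_imp.
intros y [Hy1 Hy2].
change (Rabs (W y - W x) < 1) in Hy1; change (Rabs (u n y - u n x) < eps / 3) in Hy2.
change (Rabs (g y - g x) < eps).
assert (Hy : forall z, W z <= Rabs (W x) + 1 -> Rabs (u n z - g z) < eps / 3).
{ intros z Hz. eapply Rle_lt_trans; [apply Hb|].
  eapply Rle_lt_trans; [|apply Hn].
  assert (0 < C * rho ^ n) by nra. nra. }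
pose proof (Hy x ltac:(pose proof (Rle_abs (W x)); lra)) as A1.
assert (A2 : Rabs (u n y - g y) < eps / 3).
{ apply Hy. apply Rabs_def2 in Hy1. pose proof (Rle_abs (W x)); lra. }
apply Rabs_def2 in A1; apply Rabs_def2 in A2; apply Rabs_def2 in Hy2.
apply Rabs_def1; lra.
Qed.

Fixpoint picard (I : Type) (fwd : I -> bool) (m : I -> R -> R)
    (F : I -> R -> (I -> R) -> R) (n : nat) (i : I) : R -> R :=
  match n with
  | O => fun _ => 0
  | S k => solve (fwd i) (m i) (fun x => F i x (fun j => picard I fwd m F k j x))
  end.

(** A pointwise limit, so that no complete space of functions has to be built; continuity is
    recovered from the geometric rate. *)
Definition picard_limit (I : Type) (fwd : I -> bool) (m : I -> R -> R)
    (F : I -> R -> (I -> R) -> R) (i : I) (x : R) : R :=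
  real (Lim_seq (fun n => picard I fwd m F n i x)).

(* A system s_i' = a_i s_i + F_i(x, s), each row integrated from the end [tail (fwd i)]. *)
Definition contractive (I : Type) (fwd : I -> bool) (a m W gap : I -> R -> R)
    (F : I -> R -> (I -> R) -> R) (rho delta : R) : Prop :=
  (forall i, admissible (fwd i) (a i) (m i) (W i) (gap i)) /\
  (forall i s, (forall j x, continuous (s j) x) ->
     forall x : R, continuous (fun x => F i x (fun j => s j x)) x) /\
  (forall i x u v N, 0 <= N ->
     (forall j, Rabs (u j) <= delta * W j x) -> (forall j, Rabs (v j) <= delta * W j x) ->
     (forall j, Rabs (u j - v j) <= N * W j x) ->
     Rabs (F i x u - F i x v) <= rho * N * gap i x).

(** In the norm [sup |s_i| / W_i] the ball of radius [delta] is preserved: the forcing at 0 takes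
    the share [1 - rho], its variation the share [rho]. Differences of iterates obey the same linear
    estimate with factor [rho]. *)
Lemma picard_limit_spec (I : Type) fwd a m W gap (F : I -> R -> (I -> R) -> R) (rho delta : R) :
  0 < rho < 1 -> 0 < delta -> contractive I fwd a m W gap F rho delta ->
  (forall i x, Rabs (F i x (fun _ => 0)) <= (1 - rho) * delta * gap i x) ->
  forall i x,
    is_derive (picard_limit I fwd m F i) x
      (a i x * picard_limit I fwd m F i x + F i x (fun j => picard_limit I fwd m F j x)) /\
    Rabs (picard_limit I fwd m F i x) <= delta * W i x.
Proof.
intros Hr Hd [Had [Hc Hlip]] H0.
assert (HW : forall i x, 0 < W i x) by (intros i x; apply (Had i)).
assert (HWc : forall i x, continuous (W i) x).
{ intros i x; destruct (Had i) as [_ [H _]]; destruct (H x) as [_ [d [Hdd _]]].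
  now apply is_derive_continuous with d. }
assert (HF : forall i x u, (forall j, Rabs (u j) <= delta * W j x) ->
   Rabs (F i x u) <= delta * gap i x).
{ intros i x u Hu.
  assert (A : Rabs (F i x u - F i x (fun _ => 0)) <= rho * delta * gap i x).
  { apply Hlip; [lra|exact Hu| |].
    - intros j; rewrite Rabs_R0; specialize (HW j x); nra.
    - intros j; rewrite Rminus_0_r; apply Hu. }
  specialize (H0 i x).
  replace (F i x u) with ((F i x u - F i x (fun _ => 0)) + F i x (fun _ => 0)) by ring.
  eapply Rle_trans; [apply Rabs_triang|]. lra. }
assert (Hstep : forall s, (forall j x, continuous (s j) x) ->
   (forall j x, Rabs (s j x) <= delta * W j x) -> forall i x,
   is_derive (solve (fwd i) (m i) (fun x => F i x (fun j => s j x))) x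
     (a i x * solve (fwd i) (m i) (fun x => F i x (fun j => s j x)) x
      + F i x (fun j => s j x)) /\
   Rabs (solve (fwd i) (m i) (fun x => F i x (fun j => s j x)) x) <= delta * W i x).
{ intros s Hsc Hsb i. apply (solve_spec (fwd i) (a i) (m i) (W i) (gap i)); auto; lra. }
set (p := picard I fwd m F).
assert (Hp : forall n, (forall j x, continuous (p n j) x) /\
                       (forall j x, Rabs (p n j x) <= delta * W j x)).
{ induction n as [|n [IH1 IH2]]; simpl.
  - split; intros j x; [apply (continuous_const (0 : R))|].
    change (Rabs 0 <= delta * W j x). rewrite Rabs_R0; specialize (HW j x); nra.
  - split; intros j x; [|now apply (Hstep (p n))].
    eapply is_derive_continuous, (Hstep (p n) IH1 IH2). }
assert (Hdiff : forall s s' N, 0 <= N ->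
   (forall j x, continuous (s j) x) -> (forall j x, Rabs (s j x) <= delta * W j x) ->
   (forall j x, continuous (s' j) x) -> (forall j x, Rabs (s' j x) <= delta * W j x) ->
   (forall j x, Rabs (s j x - s' j x) <= N * W j x) -> forall i x,
   Rabs (solve (fwd i) (m i) (fun x => F i x (fun j => s j x)) x
       - solve (fwd i) (m i) (fun x => F i x (fun j => s' j x)) x) <= rho * N * W i x).
{ intros s s' N HN A1 A2 B1 B2 AB i.
  pose proof (Hstep s A1 A2 i) as HA; pose proof (Hstep s' B1 B2 i) as HB.
  apply (comparison_minus (fwd i) (a i) (m i) (W i) (gap i) (rho * N) delta _ _
     (fun x => F i x (fun j => s j x)) (fun x => F i x (fun j => s' j x)));
    [apply Had|nra|apply HA|apply HB| |apply HA|apply HB].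
  intros x; now apply Hlip. }
assert (Hcauchy : forall n j x, Rabs (p (S n) j x - p n j x) <= 2 * delta * rho ^ n * W j x).
{ induction n as [|n IH]; intros j x.
  - destruct (Hp 1%nat) as [_ A1]; destruct (Hp 0%nat) as [_ A0].
    specialize (A1 j x); specialize (A0 j x). simpl (rho ^ 0).
    apply Rabs_le_between in A1, A0; apply Rabs_le; lra.
  - replace (2 * delta * rho ^ S n * W j x) with (rho * (2 * delta * rho ^ n) * W j x) by (simpl; ring).
    apply (Hdiff (p (S n)) (p n)); try apply Hp; [|exact IH].
    pose proof (pow_lt rho n ltac:(lra)); nra. }
set (s := picard_limit I fwd m F).
set (K := 2 * delta / (1 - rho)).
assert (HK : 0 < K) by (apply Rdiv_lt_0_compat; lra).
assert (Hlim : forall n j x, Rabs (p n j x - s j x) <= K * rho ^ n * W j x).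
{ intros n j x.
  replace (K * rho ^ n * W j x) with (2 * delta * W j x / (1 - rho) * rho ^ n) by (unfold K; field; lra).
  apply (geometric_limit (fun n => p n j x)); [lra|specialize (HW j x); nra|].
  intros k; eapply Rle_trans; [apply Hcauchy|right; ring]. }
assert (Hsc : forall j x, continuous (s j) x).
{ intros j; apply (continuous_geometric_limit (fun n => p n j) (s j) (W j) K rho); auto.
  intros n x; apply Hp. }
assert (Hsb : forall j x, Rabs (s j x) <= delta * W j x).
{ intros j x; apply (Rabs_le_geometric _ _ (K * W j x) rho Hr); intros n.
  specialize (Hlim n j x); pose proof (proj2 (Hp n) j x) as Hn.
  replace (s j x) with (p n j x - (p n j x - s j x)) by ring.
  eapply Rle_trans; [apply Rabs_triang|]. rewrite Rabs_Ropp. lra. }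
(* Both sides lie within a multiple of [rho^n] of the iterate of index [n + 1]. *)
assert (Hfix : forall i x, s i x = solve (fwd i) (m i) (fun x => F i x (fun j => s j x)) x).
{ intros i x. apply Rminus_diag_uniq, Rabs_eq_0, Rle_antisym; [|apply Rabs_pos].
  apply (Rabs_le_geometric _ _ (2 * rho * K * W i x) rho Hr); intros n.
  pose proof (Hlim (S n) i x) as L1.
  assert (HN : 0 <= K * rho ^ n) by (pose proof (pow_lt rho n ltac:(lra)); nra).
  pose proof (Hdiff (p n) s _ HN (proj1 (Hp n)) (proj2 (Hp n)) Hsc Hsb (Hlim n) i x) as L2.
  change (solve (fwd i) (m i) (fun x => F i x (fun j => p n j x)) x) with (p (S n) i x) in L2.
  simpl (rho ^ S n) in L1.
  apply Rabs_le_between in L1, L2; apply Rabs_le. lra. }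
intros i x; split; [|apply Hsb].
apply (is_derive_ext (solve (fwd i) (m i) (fun x => F i x (fun j => s j x)))); [intros; symmetry; apply Hfix|].
replace (s i x) with (solve (fwd i) (m i) (fun x => F i x (fun j => s j x)) x) by (symmetry; apply Hfix).
now apply Hstep.
Qed.

(** A bound [N] on the weighted distance of the two solutions improves to [rho N + eta]. Iteration
    from [2 delta] descends to the fixed point [eta / (1 - rho)] of this map. *)
Lemma contractive_stability (I : Type) fwd a m W gap (F : I -> R -> (I -> R) -> R)
    (rho delta eta : R) (s s' g : I -> R -> R) :
  0 < rho < 1 -> 0 < delta -> 0 <= eta -> contractive I fwd a m W gap F rho delta ->
  (forall i x, 0 <= gap i x) ->
  (forall i x, Rabs (s i x) <= delta * W i x) -> (forall i x, Rabs (s' i x) <= delta * W i x) ->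
  (forall i x, is_derive (s i) x (a i x * s i x + F i x (fun j => s j x))) ->
  (forall i x, is_derive (s' i) x (a i x * s' i x + (F i x (fun j => s' j x) + g i x))) ->
  (forall i x, Rabs (g i x) <= eta * gap i x) ->
  forall i x, Rabs (s i x - s' i x) <= eta / (1 - rho) * W i x.
Proof.
intros Hr Hd He [Had [Hc Hlip]] Hgap Hs Hs' Ds Ds' Hg i x.
assert (HW : forall i x, 0 < W i x) by (intros; apply (Had _)).
set (k := eta / (1 - rho)).
assert (Hk : k * (1 - rho) = eta) by (unfold k; field; lra).
assert (Hk0 : 0 <= k) by (apply Rmult_le_pos; [lra|left; apply Rinv_0_lt_compat; lra]).
assert (H : forall n j y, Rabs (s j y - s' j y) <= (k + 2 * delta * rho ^ n) * W j y).
{ induction n as [|n IH]; intros j y.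
  - specialize (Hs j y); specialize (Hs' j y); specialize (HW j y); simpl.
    apply Rabs_le_between in Hs, Hs'; apply Rabs_le. nra.
  - assert (HN : 0 <= k + 2 * delta * rho ^ n) by (pose proof (pow_lt rho n ltac:(lra)); nra).
    apply (comparison_minus (fwd j) (a j) (m j) (W j) (gap j) _ delta (s j) (s' j)
      (fun x => F j x (fun i => s i x)) (fun x => F j x (fun i => s' i x) + g j x));
      [apply Had| |apply Ds|apply Ds'| |apply Hs|apply Hs'].
    + pose proof (pow_lt rho (S n) ltac:(lra)); nra.
    + intros z.
      pose proof (Hlip j z (fun i => s i z) (fun i => s' i z) _ HN
        (fun i => Hs i z) (fun i => Hs' i z) (fun i => IH i z)) as L.
      specialize (Hg j z). specialize (Hgap j z).
      replace (_ - _) with ((F j z (fun i => s i z) - F j z (fun i => s' i z)) - g j z) by ring.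
      eapply Rle_trans; [apply Rabs_triang|]. rewrite Rabs_Ropp. simpl (rho ^ S n).
      rewrite <- Hk in Hg. lra. }
apply (Rabs_le_geometric _ _ (2 * delta * W i x) rho Hr); intros n.
specialize (H n i x). lra.
Qed.

(** * The contraction for the traveling wave *)

(* The profile with l = 0 is C = 6 w, S = 8 w, U = -2 w; the square root t of 1 - w serves as a weight decaying more slowly than C'. *)
Definition rt (x : R) : R := / sqrt (1 + exp x).
Definition lgs (x : R) : R := 1 - rt x * rt x.

Lemma rt_bounds (x : R) : 0 < rt x < 1.
Proof.
pose proof (exp_pos x).
assert (1 < sqrt (1 + exp x)) by (rewrite <- sqrt_1 at 1; apply sqrt_lt_1; lra).
unfold rt; split; [apply Rinv_0_lt_compat; lra|].
apply (Rmult_lt_reg_l (sqrt (1 + exp x))); [lra|rewrite Rinv_r; lra].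
Qed.

Lemma rt_sqr (x : R) : rt x * rt x = / (1 + exp x).
Proof.
pose proof (exp_pos x). unfold rt. rewrite <- Rinv_mult, sqrt_sqrt by lra. reflexivity.
Qed.

Lemma lgs_bounds (x : R) : 0 < lgs x < 1.
Proof. unfold lgs; pose proof (rt_bounds x); nra. Qed.

Lemma lgs_exp (x : R) : lgs x = rt x * rt x * exp x.
Proof. unfold lgs; rewrite rt_sqr; pose proof (exp_pos x); field; lra. Qed.

Lemma is_derive_rt (x : R) : is_derive rt x (- rt x * lgs x / 2).
Proof.
pose proof (exp_pos x) as He.
assert (Hs : 0 < sqrt (1 + exp x)) by (apply sqrt_lt_R0; lra).
replace (- rt x * lgs x / 2) with
  (- ((1 * exp x) * / (2 * sqrt (1 + exp x))) / (sqrt (1 + exp x) * sqrt (1 + exp x))).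
- unfold rt; auto_derive; [repeat split; lra|]. field; lra.
- rewrite lgs_exp, rt_sqr. unfold rt. rewrite sqrt_sqrt by lra. field; lra.
Qed.

Lemma is_derive_lgs (x : R) : is_derive lgs x (lgs x * (rt x * rt x)).
Proof.
unfold lgs at 1; auto_derive; [repeat split; eexists; apply is_derive_rt|].
rewrite (is_derive_unique (fun x : R => rt x) _ _ (is_derive_rt x)). unfold lgs; field.
Qed.

Lemma lgs_rt (x : R) : lgs x = 1 - rt x * rt x.
Proof. reflexivity. Qed.

Lemma is_lim_rt_p : is_lim rt p_infty 0.
Proof.
assert (H : is_lim (fun x => sqrt (1 + exp x)) p_infty p_infty).
{ apply (is_lim_comp sqrt (fun x => 1 + exp x) p_infty p_infty p_infty).
  - apply is_lim_spec; intros M; simpl.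
    exists (Rabs M * Rabs M + 1); intros x Hx. pose proof (Rle_abs M); pose proof (Rabs_pos M).
    apply Rle_lt_trans with (sqrt (Rabs M * Rabs M)); [rewrite sqrt_square; lra|].
    apply sqrt_lt_1; nra.
  - apply (is_lim_le_p_loc exp); [exists 0; intros; lra|apply is_lim_exp_p].
  - exists 0; intros; discriminate. }
apply (is_lim_inv _ _ _ H); discriminate.
Qed.

Lemma is_lim_rt_m : is_lim rt m_infty 1.
Proof.
assert (H : is_lim (fun x => sqrt (1 + exp x)) m_infty 1).
{ replace (Finite 1) with (Finite (sqrt (1 + 0))) by (rewrite Rplus_0_r, sqrt_1; reflexivity).
  apply (is_lim_comp_continuous (fun x => 1 + exp x) sqrt m_infty (1 + 0)).
  - apply is_lim_plus'; [apply is_lim_const|apply is_lim_exp_m].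
  - apply continuous_sqrt. }
replace (Finite 1) with (Rbar_inv 1) by (simpl; f_equal; field).
apply (is_lim_inv _ _ _ H). intros E; injection E; lra.
Qed.

Lemma is_lim_lgs_m : is_lim lgs m_infty 0.
Proof.
apply (is_lim_ext (fun x => 1 - rt x * rt x)); [intros; symmetry; apply lgs_rt|].
replace (Finite 0) with (Finite (1 - 1 * 1)) by (f_equal; ring).
apply is_lim_minus'; [apply is_lim_const|].
apply (is_lim_mult rt rt m_infty 1 1); simpl; auto using is_lim_rt_m.
Qed.

Lemma Rabs_le_lim_0 (f b : R -> R) (e : Rbar) :
  (forall x, Rabs (f x) <= b x) -> is_lim b e 0 -> is_lim f e 0.
Proof.
intros Hf Hb.
apply (is_lim_le_le_loc (fun x => - b x) b).
- apply filter_forall; intros x; specialize (Hf x); apply Rabs_le_between in Hf; lra.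
- replace (Finite 0) with (Rbar_opp 0) by (simpl; f_equal; ring). now apply is_lim_opp.
- exact Hb.
Qed.

Lemma is_lim_scal0 (f : R -> R) (k : R) (e : Rbar) :
  is_lim f e 0 -> is_lim (fun x => k * f x) e 0.
Proof.
intros H. replace (Finite 0) with (Finite (k * 0)) by (f_equal; ring).
now apply (is_lim_scal_l f k e (Finite 0)).
Qed.

Lemma is_lim_exp_scal_m (k : R) : 0 < k -> is_lim (fun x => exp (k * x)) m_infty 0.
Proof.
intros Hk. apply (is_lim_comp exp (fun x => k * x) m_infty 0 m_infty).
- apply is_lim_exp_m.
- apply is_lim_spec; intros M; exists (M / k); intros x Hx.
  apply (Rmult_lt_compat_l k) in Hx; [|lra].
  replace (k * (M / k)) with M in Hx by (field; lra). exact Hx.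
- exists 0; intros; discriminate.
Qed.

Lemma is_lim_exp_neg_p (k : R) : 0 < k -> is_lim (fun x => exp (- k * x)) p_infty 0.
Proof.
intros Hk. apply is_lim_opp_m_p.
apply (is_lim_ext (fun x => exp (k * x))); [intros; f_equal; ring|now apply is_lim_exp_scal_m].
Qed.

(* The unknowns are Sg = S - 4 C / 3, Pi = C' - C + C^2 / 6, Hh = C - 6 w and Pp = C' - 6 w (1 - w). The equation U'' = kappa^2 (U - G) is split through an intermediate function Z with Z' = kappa (G - Z), U' = kappa (U - Z), and Ea = Z - G, Eb = U - Z. Carrying Pp besides Pi gives an integrable weight for C' at +oo; the identity between the two is recovered in [Pf_eq]. *)
Inductive row := Sg | Pi | Hh | Pp | Ea | Eb.

(** Each row starts at an end where its weight excludes the homogeneous solution. [Sg] and [Eb] have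
    positive coefficients and start at plus infinity; [Ea] decays to the right and starts at minus
    infinity, as do [Pi], [Hh] and [Pp], which must vanish there. *)
Definition row_fwd (i : row) : bool := match i with Sg | Eb => false | _ => true end.

Definition row_a (k : R) (i : row) (x : R) : R :=
  match i with
  | Sg => 1 + 4 * lgs x
  | Pi => 0
  | Hh | Pp => 1 - 2 * lgs x
  | Ea => - k
  | Eb => k
  end.

Definition row_m (k : R) (i : row) (x : R) : R :=
  match i with
  | Sg => lgs x / rt x ^ 10
  | Pi => 1
  | Hh | Pp => lgs x * rt x ^ 2
  | Ea => exp (- k * x)
  | Eb => exp (k * x)
  end.

(** For [Hh] and [Pp] the homogeneous solution [w (1 - w)] is the translation mode, and [w^2] decays
    faster at minus infinity. At plus infinity [Pp] carries [t]: with [t^2], the decay of the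
    homogeneous solution, the gap relative to the weight would tend to 0. The increasing factor
    [1 + (1 - t) / 5] of [Pi] supplies the gap [w^3 t / 5] that absorbs products with [Pp]. *)
Definition row_W (i : row) (x : R) : R :=
  match i with
  | Sg => lgs x
  | Pi => 2 * lgs x ^ 2 * (1 + (1 - rt x) / 5)
  | Hh => 4 * lgs x ^ 2
  | Pp => 40 * lgs x ^ 2 * rt x
  | Ea => lgs x / 40
  | Eb => lgs x / 20
  end.

Definition row_gap (k : R) (i : row) (x : R) : R :=
  match i with
  | Sg => 5 * lgs x ^ 2
  | Pi => 4 * lgs x ^ 2 * rt x ^ 2 + lgs x ^ 3 * rt x / 5
  | Hh => 4 * lgs x ^ 2
  | Pp => 20 * lgs x ^ 2 * rt x
  | Ea => k * lgs x / 40
  | Eb => (k - 1) * lgs x / 20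
  end.

(** The part of [(S - 4 C / 3)'] beyond the linear term [(1 + 4 w) sg]. The ratio 4/3 makes the
    terms in [C] alone cancel, so every summand contains [sg], [pi] or [e1 + e2]. *)
Definition sg_rhs (w t sg pi h e1 e2 : R) : R :=
  2 / 3 * h * sg - sg ^ 2 / 2 - 4 / 3 * pi + (e1 + e2) * (4 * w + 2 / 3 * h - sg).

Definition row_F (k : R) (i : row) (x : R) (u : row -> R) : R :=
  let w := lgs x in let t := rt x in
  match i with
  | Sg => sg_rhs w t (u Sg) (u Pi) (u Hh) (u Ea) (u Eb)
  | Pi => (6 * w * t ^ 2 + u Pp) * (u Sg / 2 + u Ea + u Eb)
  | Hh => u Pi - u Hh ^ 2 / 6
  | Pp => (6 * w * t ^ 2 + u Pp) * (u Sg / 2 + u Ea + u Eb - u Hh / 3)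
  | Ea => - (((1 + 4 * w) * u Sg + sg_rhs w t (u Sg) (u Pi) (u Hh) (u Ea) (u Eb)) / 2
             - (6 * w * t ^ 2 + u Pp) / 3)
  | Eb => k * u Ea
  end.

Ltac derive_wt :=
  auto_derive;
  [repeat split;
   try match goal with
   | |- ex_derive (fun x => lgs x) _ => eexists; apply is_derive_lgs
   | |- ex_derive (fun x => rt x) _ => eexists; apply is_derive_rt
   end; auto
  |rewrite ?(is_derive_unique (fun x : R => lgs x) _ _ (is_derive_lgs _)),
     ?(is_derive_unique (fun x : R => rt x) _ _ (is_derive_rt _))].

Lemma row_admissible (k : R) (i : row) : 1 < k ->
  admissible (row_fwd i) (row_a k i) (row_m k i) (row_W i) (row_gap k i).
Proof.
intros Hk.
assert (Hwt : forall x, 0 < lgs x < 1 /\ 0 < rt x < 1 /\ lgs x = 1 - rt x * rt x).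
{ intros x; split; [apply lgs_bounds|]; split; [apply rt_bounds|apply lgs_rt]. }
split; [|split].
- intros x; destruct (Hwt x) as [Hw [Ht Hx]].
  assert (0 < rt x ^ 10) by (apply pow_lt; lra).
  destruct i; simpl row_m; simpl row_a; split; try apply exp_pos; try lra.
  + now apply Rdiv_lt_0_compat.
  + unfold row_m. derive_wt; [lra|]. rewrite Hx. field. lra.
  + unfold row_m. auto_derive; [trivial|ring].
  + unfold row_m. nra.
  + unfold row_m. derive_wt. rewrite Hx. field.
  + unfold row_m. nra.
  + unfold row_m. derive_wt. rewrite Hx. field.
  + unfold row_m. auto_derive; [trivial|ring].
  + unfold row_m. auto_derive; [trivial|ring].
- intros x; destruct (Hwt x) as [Hw [Ht Hx]].
  assert (Hw2 : 0 < lgs x ^ 2) by (apply pow_lt; lra).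
  assert (Ht2 : 0 < rt x ^ 2) by (apply pow_lt; lra).
  assert (Hw3 : 0 < lgs x ^ 3) by (apply pow_lt; lra).
  destruct i; unfold row_W, row_gap, row_a, row_fwd, sgn; (split; [try nra|]).
  + eexists; split; [apply is_derive_lgs|]. rewrite Hx; right; ring.
  + exists (4 * lgs x * (lgs x * (rt x * rt x)) * (1 + (1 - rt x) / 5) + 2 * lgs x ^ 2 * (rt x * lgs x / 10)).
    split; [derive_wt; field|].
    assert (0 <= lgs x ^ 2 * rt x ^ 2 * (1 - rt x)) by (apply Rmult_le_pos; nra). lra.
  + exists (8 * lgs x * (lgs x * (rt x * rt x))). split; [derive_wt; ring|].
    right; replace (lgs x) with (1 - rt x * rt x) at 3 6 by auto. rewrite Hx; ring.
  (* The logarithmic derivative of [w^2 t] exceeds [1 - 2 w] by [1 - w / 2], which is at least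
     1/2. *)
  + exists (80 * lgs x * (lgs x * (rt x * rt x)) * rt x + 40 * lgs x ^ 2 * (- rt x * lgs x / 2)).
    split; [derive_wt; field|].
    assert (0 < lgs x ^ 2 * rt x) by (apply Rmult_lt_0_compat; lra).
    replace (1 * _) with (40 * (lgs x ^ 2 * rt x) * (2 * (rt x * rt x) - lgs x / 2 - (1 - 2 * lgs x))) by field.
    replace (rt x * rt x) with (1 - lgs x) by lra. nra.
  + exists (lgs x * (rt x * rt x) / 40). split; [derive_wt; field|].
    assert (0 < lgs x * (rt x * rt x)) by (apply Rmult_lt_0_compat; nra). lra.
  + exists (lgs x * (rt x * rt x) / 20). split; [derive_wt; field|].
    assert (lgs x * (rt x * rt x) <= lgs x) by nra. lra.
- assert (Ht0 : forall n, is_lim (fun x => rt x ^ S n) p_infty 0).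
  { induction n.
    - apply (is_lim_ext rt); [intros; simpl; ring|apply is_lim_rt_p].
    - apply (is_lim_ext (fun x => rt x * rt x ^ S n)); [intros; simpl; ring|].
      replace (Finite 0) with (Finite (0 * 0)) by (f_equal; ring).
      apply (is_lim_mult rt (fun x => rt x ^ S n) p_infty 0 0); simpl; auto using is_lim_rt_p. }
  assert (Hq : forall n c, is_lim (fun x => c * (lgs x / rt x ^ n)) m_infty 0).
  { intros n c; apply is_lim_scal0.
    assert (Hn : is_lim (fun x => rt x ^ n) m_infty 1).
    { induction n; simpl; [apply is_lim_const|].
      replace (Finite 1) with (Finite (1 * 1)) by (f_equal; ring).
      apply (is_lim_mult rt (fun x => rt x ^ n) m_infty 1 1); simpl; auto using is_lim_rt_m. }
    replace (Finite 0) with (Rbar_div 0 1) by (simpl; f_equal; field).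
    apply is_lim_div; [apply is_lim_lgs_m|exact Hn| |simpl; auto].
    intros E; injection E; lra. }
  destruct i; unfold row_W, row_m, row_fwd, tail.
  + apply (is_lim_ext (fun x => rt x ^ 10)); [|apply Ht0].
    intros x; destruct (Hwt x) as [Hw [Ht _]]. field; lra.
  + apply (Rabs_le_lim_0 _ (fun x => 3 * (lgs x / rt x ^ 0))); [|apply Hq].
    intros x; destruct (Hwt x) as [Hw [Ht _]]. rewrite Rabs_right; simpl; unfold Rdiv; rewrite Rinv_1.
    * assert (lgs x * lgs x < lgs x) by nra. nra.
    * apply Rle_ge; repeat apply Rmult_le_pos; lra.
  + apply (is_lim_ext (fun x => 4 * (lgs x / rt x ^ 2))); [|apply Hq].
    intros x; destruct (Hwt x) as [Hw [Ht _]]. field; lra.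
  + apply (is_lim_ext (fun x => 40 * (lgs x / rt x ^ 1))); [|apply Hq].
    intros x; destruct (Hwt x) as [Hw [Ht _]]. field; lra.
  + apply (Rabs_le_lim_0 _ (fun x => exp (k * x))); [|apply is_lim_exp_scal_m; lra].
    intros x; destruct (Hwt x) as [Hw _]. pose proof (exp_pos (k * x)).
    unfold Rdiv; rewrite <- exp_Ropp. replace (- (- k * x)) with (k * x) by ring.
    rewrite Rabs_right; nra.
  + apply (Rabs_le_lim_0 _ (fun x => exp (- k * x))); [|apply is_lim_exp_neg_p; lra].
    intros x; destruct (Hwt x) as [Hw _]. pose proof (exp_pos (- k * x)).
    unfold Rdiv; rewrite <- exp_Ropp. replace (- (k * x)) with (- k * x) by ring.
    rewrite Rabs_right; nra.
Qed.

(** * Gains of the rows in the weighted norms *)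

Lemma Rabs_prod_diff (a b a' b' A B dA dB : R) :
  Rabs a <= A -> Rabs b' <= B -> Rabs (a - a') <= dA -> Rabs (b - b') <= dB ->
  Rabs (a * b - a' * b') <= A * dB + dA * B.
Proof.
intros Ha Hb Hda Hdb. replace (a * b - a' * b') with (a * (b - b') + (a - a') * b') by ring.
eapply Rle_trans; [apply Rabs_triang|]. rewrite !Rabs_mult.
apply Rplus_le_compat; apply Rmult_le_compat; auto using Rabs_pos.
Qed.

Ltac absb := repeat match goal with H : Rabs _ <= _ |- _ => apply Rabs_le_between in H end.

(** The linear parts have gains at most 3.5/5 in [Sg], 3.45/4 in [Pi], 2.4/4 in [Hh], 12/20 in [Pp]
    and about 1/2 in [Eb]. In [Ea] a total of about 18 stands against [k / 40], which is where a
    large [k] enters. The radius 1/20000 keeps the quadratic terms within the margin left below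
    9/10. *)
Lemma row_F_lipschitz (k : R) (i : row) (x : R) (u v : row -> R) (N : R) :
  1000 <= k -> 0 <= N ->
  (forall j, Rabs (u j) <= / 20000 * row_W j x) -> (forall j, Rabs (v j) <= / 20000 * row_W j x) ->
  (forall j, Rabs (u j - v j) <= N * row_W j x) ->
  Rabs (row_F k i x u - row_F k i x v) <= 9 / 10 * N * row_gap k i x.
Proof.
intros Hk HN Hu Hv Hd.
pose proof (Hu Sg) as us; pose proof (Hu Hh) as uh; pose proof (Hu Pp) as up;
pose proof (Hu Ea) as u1; pose proof (Hu Eb) as u2;
pose proof (Hv Sg) as vs; pose proof (Hv Hh) as vh; pose proof (Hv Pp) as vp;
pose proof (Hv Ea) as v1; pose proof (Hv Eb) as v2;
pose proof (Hd Sg) as ds; pose proof (Hd Pi) as dpi; pose proof (Hd Hh) as dh; pose proof (Hd Pp) as dp;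
pose proof (Hd Ea) as d1; pose proof (Hd Eb) as d2.
clear Hu Hv Hd. unfold row_gap, row_F, row_W, sg_rhs in *.
pose proof (lgs_bounds x) as Hw; pose proof (rt_bounds x) as Ht.
set (w := lgs x) in *; set (t := rt x) in *; clearbody w t.
set (a1 := u Sg) in *; set (a2 := u Pi) in *; set (a3 := u Hh) in *; set (a4 := u Pp) in *;
set (a5 := u Ea) in *; set (a6 := u Eb) in *.
set (b1 := v Sg) in *; set (b2 := v Pi) in *; set (b3 := v Hh) in *; set (b4 := v Pp) in *;
set (b5 := v Ea) in *; set (b6 := v Eb) in *.
clearbody a1 a2 a3 a4 a5 a6 b1 b2 b3 b4 b5 b6.
assert (w2 : 0 < w ^ 2 < w) by (simpl; nra).
assert (w3 : 0 < w ^ 3 < w ^ 2) by (simpl in *; nra).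
assert (wt : 0 < w ^ 2 * t < w ^ 2) by nra.
assert (wt2 : 0 < w ^ 2 * t ^ 2 < w ^ 2 * t) by (simpl in *; nra).
assert (wt3 : 0 < w ^ 3 * t < w ^ 2 * t) by (simpl in *; nra).
assert (Nw : 0 <= N * w) by nra.
assert (Nw2 : 0 <= N * w ^ 2 <= N * w) by nra.
assert (Nw3 : 0 <= N * w ^ 3 <= N * w ^ 2) by nra.
assert (Nwt : 0 <= N * (w ^ 2 * t) <= N * w ^ 2) by nra.
assert (Nwt2 : 0 <= N * (w ^ 2 * t ^ 2) <= N * (w ^ 2 * t)) by nra.
assert (Nwt3 : 0 <= N * (w ^ 3 * t) <= N * (w ^ 2 * t)) by nra.
assert (dpi' : Rabs (a2 - b2) <= N * (24 / 10 * w ^ 2)).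
{ eapply Rle_trans; [exact dpi|]. nra. }
clear dpi.
(* [E] stands for [U + C / 3]; its weight is 575/1000 = 1/2 + 1/40 + 1/20. *)
set (E := a1 / 2 + a5 + a6) in *; set (E' := b1 / 2 + b5 + b6) in *.
assert (hE' : Rabs E' <= 575 / 1000 * / 20000 * w) by (unfold E'; absb; apply Rabs_le; lra).
assert (dE : Rabs (E - E') <= 575 / 1000 * N * w) by (unfold E, E'; absb; apply Rabs_le; lra).
assert (hr : Rabs (a5 + a6) <= / 20000 * w) by (absb; apply Rabs_le; lra).
assert (dr : Rabs ((a5 + a6) - (b5 + b6)) <= 3 / 40 * N * w) by (absb; apply Rabs_le; lra).
assert (bS : Rabs ((2 / 3 * a3 * a1 - a1 ^ 2 / 2 - 4 / 3 * a2 + (a5 + a6) * (4 * w + 2 / 3 * a3 - a1))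
   - (2 / 3 * b3 * b1 - b1 ^ 2 / 2 - 4 / 3 * b2 + (b5 + b6) * (4 * w + 2 / 3 * b3 - b1)))
   <= 9 / 10 * N * (5 * w ^ 2)).
{ pose proof (Rabs_prod_diff _ _ _ _ _ _ _ _ uh vs dh ds) as P1.
  pose proof (Rabs_prod_diff _ _ _ _ _ _ _ _ us vs ds ds) as P2.
  assert (hb : Rabs (4 * w + 2 / 3 * b3 - b1) <= 5 * w) by (absb; apply Rabs_le; lra).
  assert (db : Rabs ((4 * w + 2 / 3 * a3 - a1) - (4 * w + 2 / 3 * b3 - b1)) <= 4 * N * w)
    by (absb; apply Rabs_le; lra).
  pose proof (Rabs_prod_diff _ _ _ _ _ _ _ _ hr hb dr db) as P3.
  clear hr dr hE' dE uh vh up vp u1 u2 v1 v2 us vs ds dh dp d1 d2 hb db.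
  absb; apply Rabs_le; split; lra. }
destruct i.
- exact bS.
- pose proof (Rabs_prod_diff _ _ _ _ _ _ _ _ up hE' dp dE) as P1.
  assert (P2 : Rabs (6 * w * t ^ 2 * (E - E')) <= 3450 / 1000 * N * (w ^ 2 * t ^ 2)).
  { rewrite Rabs_mult, (Rabs_right (6 * w * t ^ 2)) by (simpl; nra).
    eapply Rle_trans; [apply Rmult_le_compat_l; [simpl; nra|exact dE]|]. right; field. }
  clear - P1 P2 Nwt3 Nwt2.
  absb; apply Rabs_le; split; lra.
- pose proof (Rabs_prod_diff _ _ _ _ _ _ _ _ uh vh dh dh) as P1.
  assert (Nw4 : N * w ^ 4 <= N * w ^ 2) by (simpl in *; nra).
  absb; apply Rabs_le; split; lra.
- assert (hb : Rabs (E' - b3 / 3) <= / 10000 * w) by (absb; apply Rabs_le; lra).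
  assert (db : Rabs ((E - a3 / 3) - (E' - b3 / 3)) <= 2 * N * w) by (absb; apply Rabs_le; lra).
  pose proof (Rabs_prod_diff _ _ _ _ _ _ _ _ up hb dp db) as P1.
  assert (P2 : Rabs (6 * w * t ^ 2 * ((E - a3 / 3) - (E' - b3 / 3))) <= 12 * N * (w ^ 2 * t ^ 2)).
  { rewrite Rabs_mult, (Rabs_right (6 * w * t ^ 2)) by (simpl; nra).
    eapply Rle_trans; [apply Rmult_le_compat_l; [simpl; nra|exact db]|]. right; field. }
  clear - P1 P2 Nwt3 Nwt2.
  absb; apply Rabs_le; split; lra.
- assert (P2 : Rabs (4 * w * (a1 - b1)) <= 4 * N * w ^ 2).
  { rewrite Rabs_mult, (Rabs_right (4 * w)) by nra.
    eapply Rle_trans; [apply Rmult_le_compat_l; [nra|exact ds]|]. right; field. }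
  assert (Nk : 1000 * (N * w) <= k * (N * w)) by nra.
  clear - bS P2 ds dp Nk Nw2 Nwt.
  absb; apply Rabs_le; split; lra.
- assert (Nk : 1000 * (N * w) <= k * (N * w)) by nra.
  replace (k * a5 - k * b5) with (k * (a5 - b5)) by ring.
  rewrite Rabs_mult, (Rabs_right k) by lra.
  eapply Rle_trans; [apply Rmult_le_compat_l; [lra|exact d1]|]. lra.
Qed.

(** The radius stays free because existence uses [800 / k], while the comparison of two values of
    [k] uses the common radius 1/20000. *)
Lemma row_contractive (k delta : R) : 1000 <= k -> 0 < delta <= / 20000 ->
  contractive row row_fwd (row_a k) (row_m k) row_W (row_gap k) (row_F k) (9 / 10) delta.
Proof.
intros Hk Hd; split; [|split].
- intros i; apply row_admissible; lra.
- intros i s Hs x.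
  assert (Hw : continuous lgs x) by (eapply is_derive_continuous, is_derive_lgs).
  assert (Ht : continuous rt x) by (eapply is_derive_continuous, is_derive_rt).
  pose proof (fun j => Hs j x) as Hs'.
  assert (forall f g : R -> R, continuous f x -> continuous g x -> continuous (fun x => f x + g x) x)
    by (intros f g; apply (continuous_plus f g)).
  assert (forall f g : R -> R, continuous f x -> continuous g x -> continuous (fun x => f x * g x) x)
    by (intros f g; apply (continuous_mult f g)).
  assert (Hc : forall c : R, continuous (fun _ : R => c) x) by (intros; apply continuous_const).
  assert (forall f g : R -> R, continuous f x -> continuous g x -> continuous (fun x => f x - g x) x)
    by (intros f g; apply (continuous_minus f g)).
  assert (forall f : R -> R, continuous f x -> continuous (fun x => - f x) x)
    by (intros f; apply (continuous_opp f)).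
  assert (forall f : R -> R, continuous f x -> continuous (fun x => f x ^ 2) x).
  { intros f Hf; simpl; auto. }
  assert (forall (f : R -> R) c, continuous f x -> continuous (fun x => f x / c) x)
    by (intros f c Hf; unfold Rdiv; auto).
  pose proof (Hs' Sg); pose proof (Hs' Pi); pose proof (Hs' Hh); pose proof (Hs' Pp);
    pose proof (Hs' Ea); pose proof (Hs' Eb).
  assert (HS : continuous (fun x => sg_rhs (lgs x) (rt x) (s Sg x) (s Pi x) (s Hh x) (s Ea x) (s Eb x)) x)
    by (unfold sg_rhs; auto 20).
  destruct i; unfold row_F; [exact HS|auto 20..].
- intros i x u v N HN Hu Hv Huv.
  assert (HW : forall j, 0 < row_W j x) by (intros j; apply (row_admissible k j); lra).
  apply row_F_lipschitz; auto; intros j.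
  + eapply Rle_trans; [apply Hu|]. specialize (HW j); nra.
  + eapply Rle_trans; [apply Hv|]. specialize (HW j); nra.
Qed.

(* At s = 0 the only forcing is 2 w (1 - w) in row Ea; 800 / k is the radius for which it is at most (1 - 9/10) (800 / k) gap. *)
Definition is_sol (k : R) (s : row -> R -> R) : Prop :=
  forall i x, is_derive (s i) x (row_a k i x * s i x + row_F k i x (fun j => s j x)) /\
    Rabs (s i x) <= 800 / k * row_W i x.

Definition sol (k : R) : row -> R -> R := picard_limit row row_fwd (row_m k) (row_F k).

(** Large enough for [800 / k] to be at most 1/20000. *)
Definition k0 : R := 20000000.

Lemma delta_small (k : R) : k0 <= k -> 0 < 800 / k <= / 20000.
Proof.
unfold k0; intros Hk; split; [apply Rdiv_lt_0_compat; lra|].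
apply (Rmult_le_reg_r k); [lra|]. unfold Rdiv; rewrite Rmult_assoc, Rinv_l; lra.
Qed.

Lemma row_gap_pos (k : R) (i : row) (x : R) : 1 < k -> 0 < row_gap k i x.
Proof.
intros Hk; pose proof (lgs_bounds x); pose proof (rt_bounds x).
assert (0 < lgs x ^ 2) by (apply pow_lt; lra).
assert (0 < lgs x ^ 3) by (apply pow_lt; lra).
assert (0 < rt x ^ 2) by (apply pow_lt; lra).
destruct i; unfold row_gap; nra.
Qed.

Lemma sol_is_sol (k : R) : k0 <= k -> is_sol k (sol k).
Proof.
intros Hk i x; pose proof (delta_small k Hk) as Hd. assert (Hk' := Hk); unfold k0 in Hk'.
apply (picard_limit_spec row row_fwd (row_a k) (row_m k) row_W (row_gap k) (row_F k) (9 / 10));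
  [lra|lra|apply row_contractive; lra|].
clear i x; intros i x; pose proof (row_gap_pos k i x ltac:(lra)) as Hg.
assert (Hz : 0 <= (1 - 9 / 10) * (800 / k) * row_gap k i x) by nra.
destruct i; unfold row_F, sg_rhs;
  try (match goal with |- Rabs ?z <= _ => replace z with 0 by field end; rewrite Rabs_R0; exact Hz).
pose proof (lgs_bounds x) as Hw; pose proof (rt_bounds x) as Ht.
replace (- _) with (2 * lgs x * rt x ^ 2) by field.
replace (_ * row_gap _ _ _) with (2 * lgs x) by (unfold row_gap; field; lra).
assert (0 < rt x ^ 2 < 1) by (simpl; nra).
rewrite Rabs_right; nra.
Qed.

Lemma sol_bound (k : R) s : k0 <= k -> is_sol k s ->
  forall i x, Rabs (s i x) <= / 20000 * row_W i x.
Proof.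
intros Hk Hs i x; eapply Rle_trans; [apply Hs|].
assert (0 < row_W i x) by (apply (row_admissible k i); unfold k0 in Hk; lra).
pose proof (delta_small k Hk); nra.
Qed.

(** Only the rows [Ea] and [Eb] contain [k]. Hence [s'] solves the system for [k] up to a forcing
    [k - k'] times components that are already small, and the factor [1 / (1 - 9 / 10)] turns 20000
    into 2000. *)
Lemma sol_stability (k k' : R) s s' : k0 <= k -> k0 <= k' -> is_sol k s -> is_sol k' s' ->
  forall i x, Rabs (s i x - s' i x) <= Rabs (k - k') / 2000 * row_W i x.
Proof.
intros Hk Hk' Hs Hs' i x.
pose proof (sol_bound k s Hk Hs) as Bs; pose proof (sol_bound k' s' Hk' Hs') as Bs'.
unfold k0 in *.
replace (Rabs (k - k') / 2000) with ((Rabs (k - k') / 20000) / (1 - 9 / 10)) by field.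
pose (g := fun (i : row) (x : R) => match i with
  | Ea => (k - k') * s' Ea x | Eb => (k' - k) * (s' Ea x + s' Eb x) | _ => 0 end).
apply (contractive_stability row row_fwd (row_a k) (row_m k) row_W (row_gap k) (row_F k)
  (9 / 10) (/ 20000) (Rabs (k - k') / 20000) s s' g); try lra; auto.
- pose proof (Rabs_pos (k - k')); lra.
- apply row_contractive; lra.
- intros; left; apply row_gap_pos; lra.
- intros j y; apply Hs.
- intros j y.
  replace (row_a k j y * s' j y + (row_F k j y (fun j => s' j y) + g j y))
    with (row_a k' j y * s' j y + row_F k' j y (fun j => s' j y)); [apply Hs'|].
  destruct j; unfold row_a, row_F, g; ring.
- intros j y; pose proof (row_gap_pos k j y ltac:(lra)) as Hg; pose proof (Rabs_pos (k - k')) as Ha.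
  assert (Hz : 0 <= Rabs (k - k') / 20000 * row_gap k j y) by nra.
  pose proof (lgs_bounds y) as Hw.
  pose proof (Bs' Ea y) as B1; pose proof (Bs' Eb y) as B2; unfold row_W in B1, B2.
  destruct j; unfold g; try (rewrite Rabs_R0; exact Hz); rewrite Rabs_mult; unfold row_gap.
  + assert (lgs y <= k * lgs y) by nra.
    replace (Rabs (k - k') / 20000 * (k * lgs y / 40))
      with (Rabs (k - k') * (/ 20000 * (k * lgs y / 40))) by field.
    apply Rmult_le_compat_l; [lra|]. lra.
  + assert (10 * lgs y <= k * lgs y) by nra.
    rewrite (Rabs_minus_sym k' k).
    replace (Rabs (k - k') / 20000 * ((k - 1) * lgs y / 20))
      with (Rabs (k - k') * (/ 20000 * ((k - 1) * lgs y / 20))) by field.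
    apply Rmult_le_compat_l; [lra|]. eapply Rle_trans; [apply Rabs_triang|]. lra.
Qed.

(** * Recovering the wave equations from the rows *)

Definition Cf (s : row -> R -> R) (x : R) : R := 6 * lgs x + s Hh x.
(** The candidate for [C'] given by row [Pp]; that it is the derivative of [Cf] rests on [Pf_eq]. *)
Definition Pf (s : row -> R -> R) (x : R) : R := 6 * lgs x * rt x ^ 2 + s Pp x.
Definition Sf (s : row -> R -> R) (x : R) : R := s Sg x + 4 / 3 * Cf s x.
Definition Uf (s : row -> R -> R) (x : R) : R := s Sg x / 2 - Cf s x / 3 + s Ea x + s Eb x.

Lemma is_derive_eq (f : R -> R) (x l l' : R) : is_derive f x l -> l = l' -> is_derive f x l'.
Proof. now intros H <-. Qed.

Lemma sol_derivatives (k : R) s : is_sol k s -> forall x,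
  let w := lgs x in let t := rt x in
  let G := ((1 + 4 * w) * s Sg x + sg_rhs w t (s Sg x) (s Pi x) (s Hh x) (s Ea x) (s Eb x)) in
  is_derive (s Sg) x G /\
  is_derive (s Pi) x (Pf s x * (s Sg x / 2 + s Ea x + s Eb x)) /\
  is_derive (s Hh) x ((1 - 2 * w) * s Hh x + (s Pi x - s Hh x ^ 2 / 6)) /\
  is_derive (s Pp) x ((1 - 2 * w) * s Pp x + Pf s x * (s Sg x / 2 + s Ea x + s Eb x - s Hh x / 3)) /\
  is_derive (s Ea) x (- k * s Ea x - (G / 2 - Pf s x / 3)) /\
  is_derive (s Eb) x (k * s Eb x + k * s Ea x).
Proof.
intros Hs x w t G.
refine (conj _ (conj _ (conj _ (conj _ (conj _ _))))); (eapply is_derive_eq; [apply Hs|]); unfold row_a, row_F, Pf, G, w, t; field.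
Qed.

Ltac derive_sol Hs z :=
  let D1 := fresh in let D2 := fresh in let D3 := fresh in
  let D4 := fresh in let D5 := fresh in let D6 := fresh in
  destruct (sol_derivatives _ _ Hs z) as [D1 [D2 [D3 [D4 [D5 D6]]]]];
  pose proof (is_derive_lgs z); pose proof (is_derive_rt z);
  auto_derive;
  [repeat split; try (eexists; eassumption)
  |repeat match goal with H : is_derive ?f z ?l |- _ =>
     rewrite ?(is_derive_unique (fun x : R => f x) z _ H); clear H end].

(** The defect [D] of the identity solves [D' = (1 - 2 w - h / 3) D], with [h] the row [Hh]. A
    nonzero solution decays only like [w] at minus infinity, whereas [D] is of order [w^2]. Treating
    [h D / 3] as forcing halves the bound at each comparison. *)
Lemma Pf_eq (k : R) s : k0 <= k -> is_sol k s ->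
  forall x, Pf s x = Cf s x - Cf s x ^ 2 / 6 + s Pi x.
Proof.
intros Hk Hs x.
pose proof (sol_bound k s Hk Hs) as B.
pose (D := fun x => 6 * lgs x + s Hh x - (6 * lgs x + s Hh x) ^ 2 / 6 + s Pi x - (6 * lgs x * rt x ^ 2 + s Pp x)).
assert (H : forall n y, Rabs (D y) <= (/ 2) ^ n * row_W Hh y).
{ induction n as [|n IH]; intros y.
  - pose proof (B Hh y) as b1; pose proof (B Pi y) as b2; pose proof (B Pp y) as b3.
    pose proof (lgs_bounds y) as Hw; pose proof (rt_bounds y) as Ht.
    unfold row_W in *; simpl (_ ^ 0).
    replace (D y) with ((1 - 2 * lgs y) * s Hh y - s Hh y ^ 2 / 6 + s Pi y - s Pp y)
      by (unfold D; rewrite lgs_rt; field).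
    assert (0 < lgs y ^ 2 < 1) by (simpl; nra).
    assert (0 < lgs y ^ 2 * rt y < lgs y ^ 2) by nra.
    assert (b4 : Rabs ((1 - 2 * lgs y) * s Hh y) <= 1 * (/ 20000 * (4 * lgs y ^ 2))).
    { rewrite Rabs_mult; apply Rmult_le_compat; auto using Rabs_pos. apply Rabs_le; lra. }
    assert (b5 : Rabs (s Hh y ^ 2) <= 1 * (/ 20000 * (4 * lgs y ^ 2))).
    { simpl; rewrite Rmult_1_r, Rabs_mult; apply Rmult_le_compat; auto using Rabs_pos. lra. }
    assert (b6 : Rabs (s Pi y) <= 3 * lgs y ^ 2).
    { eapply Rle_trans; [exact b2|]. nra. }
    absb. apply Rabs_le; lra.
  - apply (comparison true (row_a k Hh) (row_m k Hh) (row_W Hh) (row_gap k Hh)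
      ((/ 2) ^ S n) ((/ 2) ^ n) D (fun y => - (s Hh y / 3) * D y)).
    + apply (row_admissible k Hh); unfold k0 in Hk; lra.
    + apply pow_le; lra.
    + intros z; unfold D. derive_sol Hs z. unfold row_a, Pf. rewrite lgs_rt. field.
    + intros z. rewrite Rabs_mult, Rabs_Ropp.
      replace (_ * row_gap k Hh z) with (/ 2 * ((/ 2) ^ n * row_W Hh z)) by (unfold row_gap, row_W; simpl; ring).
      apply Rmult_le_compat; auto using Rabs_pos.
      pose proof (B Hh z) as b; pose proof (lgs_bounds z); unfold row_W in b.
      assert (lgs z ^ 2 < 1) by (simpl; nra). absb; apply Rabs_le; lra.
    + exact IH. }
assert (H0 : Rabs (D x) <= 0).
{ apply (Rabs_le_geometric _ _ (row_W Hh x) (/ 2)); [lra|].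
  intros n; specialize (H n x); lra. }
assert (H1 : D x = 0) by (absb; lra).
unfold D in H1; unfold Cf, Pf; lra.
Qed.

Lemma is_derive_Cf (k : R) s : k0 <= k -> is_sol k s -> forall x, is_derive (Cf s) x (Pf s x).
Proof.
intros Hk Hs x. pose proof (Pf_eq k s Hk Hs x) as HP. unfold Cf, Pf in *.
derive_sol Hs x. rewrite HP, lgs_rt. field.
Qed.

Lemma is_derive_Pf (k : R) s : is_sol k s ->
  forall x, is_derive (Pf s) x ((1 + Uf s x) * Pf s x).
Proof.
intros Hs x. unfold Pf at 1. derive_sol Hs x. unfold Uf, Cf, Pf. rewrite lgs_rt. field.
Qed.

Lemma is_derive_Sf (k : R) s : k0 <= k -> is_sol k s ->
  forall x, is_derive (Sf s) x (Sf s x + Uf s x * (2 * Cf s x - Sf s x)).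
Proof.
intros Hk Hs x. pose proof (is_derive_Cf k s Hk Hs x) as HC.
pose proof (Pf_eq k s Hk Hs x) as HP.
unfold Sf at 1. derive_sol Hs x. rewrite HP. unfold Sf, Uf, sg_rhs, Cf. field.
Qed.

Lemma is_derive_Uf (k : R) s : k0 <= k -> is_sol k s ->
  forall x, is_derive (Uf s) x (k * s Eb x).
Proof.
intros Hk Hs x. pose proof (is_derive_Cf k s Hk Hs x) as HC.
unfold Uf. derive_sol Hs x. field.
Qed.

(** * Monotonicity of the profile *)

Lemma integrating_factor (a : R -> R) : (forall x, continuous a x) ->
  exists m : R -> R, (forall x, 0 < m x /\ is_derive m x (a x * m x)) /\ m 0 = 1.
Proof.
intros Ha; exists (fun x => exp (RInt a 0 x)); split.
- intros x; split; [apply exp_pos|].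
  assert (H : is_derive (fun x => RInt a 0 x) x (a x)).
  { apply (is_derive_RInt a (fun x => RInt a 0 x) 0 x); [|apply Ha].
    apply filter_forall; intros y; apply (RInt_correct a).
    apply (ex_RInt_continuous a); intros; apply Ha. }
  apply (is_derive_comp exp (fun x => RInt a 0 x) x (exp (RInt a 0 x)) (a x)); [|exact H].
  apply is_derive_exp.
- rewrite RInt_point; apply exp_0.
Qed.

(** The quotient of [y] by an integrating factor is constant, so the sign at one point decides
    everywhere. *)
Lemma linear_positive (a y : R -> R) (x0 : R) : (forall x, continuous a x) ->
  (forall x, is_derive y x (a x * y x)) -> 0 < y x0 -> forall x, 0 < y x.
Proof.
intros Ha Hy H0 x. destruct (integrating_factor a Ha) as [m [Hm _]].
assert (Hq : forall c z, is_derive (fun x => c * (y x / m x)) z 0).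
{ intros c z; destruct (Hm z) as [Hmz Hdm].
  auto_derive.
  - repeat split; try (eexists; eassumption); try (eexists; apply Hy); lra.
  - rewrite (is_derive_unique (fun x : R => m x) _ _ Hdm), (is_derive_unique (fun x : R => y x) _ _ (Hy z)). field; lra. }
assert (E : forall c u v, u <= v -> c * (y u / m u) <= c * (y v / m v)).
{ intros c; apply (derive_nonneg_le _ (fun _ => 0) (Hq c)); intros; lra. }
assert (Ex : y x / m x = y x0 / m x0).
{ destruct (Rle_dec x x0) as [L|L].
  - pose proof (E 1 x x0 L); pose proof (E (-1) x x0 L); lra.
  - pose proof (E 1 x0 x ltac:(lra)); pose proof (E (-1) x0 x ltac:(lra)); lra. }
destruct (Hm x) as [Hmx _]; destruct (Hm x0) as [Hm0 _].
replace (y x) with (m x * (y x / m x)) by (field; lra).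
rewrite Ex. apply Rmult_lt_0_compat; [lra|]. now apply Rdiv_lt_0_compat.
Qed.

Lemma sol_estimates (k : R) s : k0 <= k -> is_sol k s -> forall x,
  Rabs (Uf s x + 2 * lgs x) <= / 10000 * lgs x /\
  Rabs (s Ea x + s Eb x) <= / 200000 * lgs x /\
  Rabs (Cf s x - 6 * lgs x) <= / 5000 * lgs x /\
  Rabs (Sf s x) <= 9 * lgs x /\
  Pf s x <= 7 * lgs x /\ Pf s x <= 7 * rt x.
Proof.
intros Hk Hs x. pose proof (sol_bound k s Hk Hs) as B.
pose proof (B Sg x) as b1; pose proof (B Hh x) as b2; pose proof (B Pp x) as b3;
pose proof (B Ea x) as b4; pose proof (B Eb x) as b5; clear B; unfold row_W in *.
pose proof (lgs_bounds x) as Hw; pose proof (rt_bounds x) as Ht.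
assert (0 < lgs x ^ 2 < lgs x) by (simpl; nra).
assert (0 < lgs x ^ 2 * rt x < lgs x) by nra.
assert (lgs x ^ 2 * rt x < rt x) by nra.
assert (0 < lgs x * rt x ^ 2 < lgs x) by (simpl; nra).
assert (lgs x * rt x ^ 2 < rt x) by (simpl; nra).
unfold Uf, Sf, Cf, Pf in *. absb.
repeat split; try (apply Rabs_le); lra.
Qed.

Lemma Pf_pos (k : R) s : k0 <= k -> is_sol k s -> forall x, 0 < Pf s x.
Proof.
intros Hk Hs. apply (linear_positive (fun x => 1 + Uf s x) (Pf s) 0).
- intros x; apply (continuous_plus (fun _ => 1) (Uf s)); [apply continuous_const|].
  eapply is_derive_continuous, is_derive_Uf; eauto.
- intros; now apply (is_derive_Pf k).
- pose proof (sol_bound k s Hk Hs Pp 0) as b; unfold row_W in b.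
  pose proof (lgs_bounds 0) as Hw; pose proof (rt_bounds 0) as Ht.
  pose proof (rt_sqr 0) as H2; rewrite exp_0 in H2.
  unfold Pf. simpl (rt 0 ^ 2); rewrite Rmult_1_r, H2.
  assert (lgs 0 ^ 2 * rt 0 <= lgs 0) by (simpl; nra). absb. lra.
Qed.

Lemma is_lim_bounded_div (W m b : R -> R) (e : Rbar) (M : R) :
  (forall x, 0 <= W x <= M) -> (forall x, 0 < m x) -> is_lim b e 0 ->
  Rbar_locally' e (fun x => / m x <= b x) -> is_lim (fun x => W x / m x) e 0.
Proof.
intros HW Hm Hb Hl.
apply (is_lim_le_le_loc (fun _ => 0) (fun x => M * b x)).
- revert Hl; apply filter_imp; intros x Hx. pose proof (Rinv_0_lt_compat _ (Hm x)).
  specialize (HW x). unfold Rdiv; split; [nra|]. apply Rmult_le_compat; lra.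
- apply is_lim_const.
- now apply is_lim_scal0.
Qed.

Definition Yf (s : row -> R -> R) (x : R) : R := Sf s x + Uf s x * (2 * Cf s x - Sf s x).

Section Monotonicity.
Variables (k : R) (s : row -> R -> R).
Hypotheses (Hk : k0 <= k) (Hs : is_sol k s).

(* [Yf s], [- k * s Eb] and [- k * s Ea] are S', -U' and Z'; 4/3, 1/3 and -1/3 are their exact ratios to C' at l = 0. *)
Let xh x := - k * s Eb x - Pf s x / 3.
Let yh x := Yf s x - 4 / 3 * Pf s x.
Let zh x := - k * s Ea x + Pf s x / 3.
(** The coefficient 1/4 is the bound aimed at for [xh]: being below 1/3, it keeps
    [- U' = C' / 3 + xh] positive. *)
Let W n x := Pf s x / 4 + n * lgs x.

Lemma W_facts n x : 0 < n -> 0 < W n x <= 2 + n /\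
  is_derive (W n) x ((1 + Uf s x) * Pf s x / 4 + n * (lgs x * (rt x * rt x))) /\
  Rabs (1 + Uf s x) <= 2 /\
  Rabs ((1 + Uf s x) * Pf s x / 4 + n * (lgs x * (rt x * rt x))) <= 2 * W n x /\
  Pf s x <= 4 * W n x.
Proof.
intros Hn. destruct (sol_estimates k s Hk Hs x) as [Hu [_ [_ [_ [Hp _]]]]].
pose proof (Pf_pos k s Hk Hs x) as HP.
pose proof (lgs_bounds x) as Hw; pose proof (rt_bounds x) as Ht.
assert (Hn1 : 0 < n * lgs x) by nra. assert (n * lgs x <= n) by nra.
assert (HU : Rabs (1 + Uf s x) <= 2) by (absb; apply Rabs_le; lra).
repeat match goal with |- _ /\ _ => split end; auto; unfold W; try lra.
- pose proof (is_derive_Pf k s Hs x) as D1. pose proof (is_derive_lgs x) as D2.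
  auto_derive; [repeat split; eexists; eassumption|].
  rewrite (is_derive_unique (fun x : R => Pf s x) _ _ D1), (is_derive_unique (fun x : R => lgs x) _ _ D2).
  field.
- eapply Rle_trans; [apply Rabs_triang|].
  rewrite (Rabs_right (n * _)) by (apply Rle_ge, Rmult_le_pos; nra).
  unfold Rdiv; rewrite !Rabs_mult, (Rabs_right (Pf s x)), (Rabs_right (/ 4)) by lra.
  assert (Rabs (1 + Uf s x) * Pf s x <= 2 * Pf s x) by (apply Rmult_le_compat_r; lra).
  assert (n * (lgs x * (rt x * rt x)) <= n * lgs x)
    by (apply Rmult_le_compat_l; [lra|assert (rt x * rt x < 1) by nra; nra]). lra.
Qed.

(** [W n] varies at a relative rate of at most 2, so against the rates [k] and [- k] only 2 is
    lost. *)
Lemma W_admissible_fast (fwd : bool) n : 0 < n ->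
  admissible fwd (fun _ => - sgn fwd * k) (fun x => exp (- sgn fwd * k * x)) (W n)
    (fun x => (k - 2) * W n x).
Proof.
intros Hn. assert (Hk' := Hk); unfold k0 in Hk'. split; [|split].
- intros x; split; [apply exp_pos|]. auto_derive; [trivial|ring].
- intros x; destruct (W_facts n x Hn) as [[H1 _] [H2 [_ [H3 _]]]]. split; [exact H1|].
  eexists; split; [exact H2|]. absb. destruct fwd; simpl; lra.
- apply (is_lim_bounded_div _ _ (fun x => exp (sgn fwd * k * x)) _ (2 + n)).
  + intros x; destruct (W_facts n x Hn) as [H1 _]; lra.
  + intros; apply exp_pos.
  + destruct fwd; simpl.
    * apply (is_lim_ext (fun x => exp (k * x))); [intros; f_equal; ring|apply is_lim_exp_scal_m; lra].
    * apply (is_lim_ext (fun x => exp (- k * x))); [intros; f_equal; ring|apply is_lim_exp_neg_p; lra].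
  + apply filter_forall; intros x; right; rewrite <- exp_Ropp; f_equal; ring.
Qed.

(** [U] is close to [-2 w], so both terms of the gap are positive. Since [1 - U >= 1], the
    integrating factor is at least [exp x] for [x >= 0], which gives the limit at plus infinity. *)
Lemma W_admissible_slow n : 0 < n -> exists m,
  admissible false (fun x => 1 - Uf s x) m (W n)
    (fun x => - Uf s x * Pf s x / 2 + n * lgs x * (lgs x - Uf s x)).
Proof.
intros Hn.
assert (Hc : forall x, continuous (fun x => 1 - Uf s x) x).
{ intros x; apply (continuous_minus (fun _ => 1) (Uf s)); [apply continuous_const|].
  eapply is_derive_continuous, is_derive_Uf; eauto. }
destruct (integrating_factor _ Hc) as [m [Hm Hm0]].
exists m; split; [exact Hm|split].
- intros x; destruct (W_facts n x Hn) as [[H1 _] [H2 _]]. split; [exact H1|].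
  eexists; split; [exact H2|]. simpl; unfold W. rewrite lgs_rt. right; field.
- assert (Hg : forall u v, u <= v -> m u * exp (- u) <= m v * exp (- v)).
  { apply (derive_nonneg_le _ (fun x => - Uf s x * (m x * exp (- x)))).
    - intros x; destruct (Hm x) as [_ Hd]. auto_derive; [repeat split; eexists; eassumption|].
      rewrite (is_derive_unique (fun x : R => m x) _ _ Hd). ring.
    - intros x; destruct (Hm x) as [Hp _]. pose proof (exp_pos (- x)).
      destruct (sol_estimates k s Hk Hs x) as [Hu _]. pose proof (lgs_bounds x). absb.
      apply Rmult_le_pos; [lra|nra]. }
  apply (is_lim_bounded_div _ _ (fun x => exp (- (1) * x)) _ (2 + n)).
  + intros x; destruct (W_facts n x Hn) as [H1 _]; lra.
  + apply Hm.
  + apply (is_lim_exp_neg_p 1); lra.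
  + exists 0; intros x Hx.
    pose proof (Hg 0 x ltac:(lra)) as H. rewrite Ropp_0, exp_0, Hm0 in H.
    replace (- (1) * x) with (- x) by ring.
    destruct (Hm x) as [Hp _]. apply (Rmult_le_reg_l (m x)); [lra|]. rewrite Rinv_r; lra.
Qed.

Lemma is_derive_Yf x : is_derive (Yf s) x
  ((1 - Uf s x) * Yf s x + k * s Eb x * (2 * Cf s x - Sf s x) + 2 * Uf s x * Pf s x).
Proof.
pose proof (is_derive_Cf k s Hk Hs x) as D1; pose proof (is_derive_Sf k s Hk Hs x) as D2;
pose proof (is_derive_Uf k s Hk Hs x) as D3.
unfold Yf at 1. auto_derive; [repeat split; eexists; eassumption|].
rewrite (is_derive_unique (fun x : R => Sf s x) _ _ D2), (is_derive_unique (fun x : R => Cf s x) _ _ D1),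
 (is_derive_unique (fun x : R => Uf s x) _ _ D3). unfold Yf. ring.
Qed.

(* The loop xh -> yh -> zh -> xh has gain 4/5 in the norm weighted by W n, so the term n w, which only serves to make xh bounded a priori, can be iterated away. *)
Lemma comparison_step n : 0 < n -> (forall x, Rabs (xh x) <= W n x) ->
  (forall x, Rabs (yh x) <= 7 / 5 * W n x) /\ (forall x, Rabs (zh x) <= 3 / 4 * W n x) /\
  (forall x, Rabs (xh x) <= 4 / 5 * W n x).
Proof.
intros Hn Hx. assert (Hk' := Hk); unfold k0 in Hk'.
assert (HD : forall x, 2 * Cf s x - Sf s x = 2 * (s Ea x + s Eb x) - 2 * Uf s x)
  by (intros; unfold Sf, Uf; field).
assert (Hnw : forall x, lgs x <= / n * W n x).
{ intros x; pose proof (Pf_pos k s Hk Hs x). pose proof (Rinv_0_lt_compat n Hn). unfold W.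
  replace (/ n * (Pf s x / 4 + n * lgs x)) with (lgs x + / n * (Pf s x / 4)) by (field; lra). nra. }
(* The ratios 4/3 and 1/3 make the terms in [U P] cancel, leaving [-(2 C - S) xh] and a small
   multiple of [(Ea + Eb) P]. With [2 C - S] close to [4 w], the forcing is about [w P + 4 n w^2]
   against a gap of about [w P + 3 n w^2]; 7/5 leaves room above 4/3. *)
assert (Hy : forall x, Rabs (yh x) <= 7 / 5 * W n x).
{ destruct (W_admissible_slow n Hn) as [m Ha].
  apply (comparison _ _ _ _ _ (7 / 5) (40 * / n) yh
    (fun x => - ((2 * Cf s x - Sf s x) * xh x) - 2 / 3 * ((s Ea x + s Eb x) * Pf s x)) Ha); [lra| | |].
  - intros x. unfold yh at 1. pose proof (is_derive_Yf x) as D1; pose proof (is_derive_Pf k s Hs x) as D2.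
    auto_derive; [repeat split; eexists; eassumption|].
    rewrite (is_derive_unique (fun x : R => Yf s x) _ _ D1), (is_derive_unique (fun x : R => Pf s x) _ _ D2).
    rewrite HD. unfold yh, xh. field.
  - intros x. rewrite HD.
    destruct (sol_estimates k s Hk Hs x) as [Hu [Hr _]].
    pose proof (Pf_pos k s Hk Hs x) as HP; pose proof (lgs_bounds x) as Hw.
    assert (B1 : Rabs ((2 * (s Ea x + s Eb x) - 2 * Uf s x) * xh x)
      <= (- 2 * Uf s x + / 100000 * lgs x) * W n x).
    { rewrite Rabs_mult; apply Rmult_le_compat; auto using Rabs_pos.
      absb; apply Rabs_le; lra. }
    assert (B2 : Rabs ((s Ea x + s Eb x) * Pf s x) <= / 200000 * lgs x * Pf s x).
    { rewrite Rabs_mult, (Rabs_right (Pf s x)) by lra. apply Rmult_le_compat_r; lra. }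
    assert (B3 : 19998 / 10000 * lgs x * Pf s x <= - Uf s x * Pf s x)
      by (apply Rmult_le_compat_r; absb; lra).
    assert (B4 : n * lgs x * ((- 2 * Uf s x + / 100000 * lgs x)) <= n * lgs x * (7 / 5 * (lgs x - Uf s x)))
      by (apply Rmult_le_compat_l; [nra|absb; lra]).
    assert (B5 : 0 < lgs x * Pf s x) by nra.
    unfold W in B1. clear Hu Hr Hx.
    eapply Rle_trans; [apply Rabs_triang|]. rewrite !Rabs_Ropp, (Rabs_mult (2 / 3)), (Rabs_right (2 / 3)) by lra.
    lra.
  - intros x. destruct (sol_estimates k s Hk Hs x) as [Hu [Hr [_ [HS [HP _]]]]].
    pose proof (Pf_pos k s Hk Hs x) as HP0; pose proof (lgs_bounds x) as Hw.
    assert (B1 : Rabs (Uf s x * (2 * Cf s x - Sf s x)) <= 3 * (5 * lgs x)).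
    { rewrite HD, Rabs_mult; apply Rmult_le_compat; auto using Rabs_pos; absb; apply Rabs_le; lra. }
    rewrite Rmult_assoc. eapply Rle_trans; [|apply Rmult_le_compat_l; [lra|apply Hnw]].
    unfold yh, Yf. absb; apply Rabs_le; lra. }
assert (HUP : forall x, Rabs ((1 + Uf s x) * Pf s x / 3) <= 8 / 3 * W n x).
{ intros x; destruct (W_facts n x Hn) as [_ [_ [HU [_ HP]]]]. pose proof (Pf_pos k s Hk Hs x).
  unfold Rdiv; rewrite !Rabs_mult, (Rabs_right (Pf s x)), (Rabs_right (/ 3)) by lra.
  assert (Rabs (1 + Uf s x) * Pf s x <= 2 * Pf s x) by (apply Rmult_le_compat_r; lra). lra. }
assert (Hbig : forall x, (k + 7) * lgs x <= (k + 7) * / n * W n x).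
{ intros x; rewrite Rmult_assoc; apply Rmult_le_compat_l; [lra|apply Hnw]. }
assert (He : forall i x, row_W i x <= lgs x -> Rabs (k * s i x) <= k * lgs x).
{ intros i x Hi. rewrite Rabs_mult, (Rabs_right k) by lra. apply Rmult_le_compat_l; [lra|].
  eapply Rle_trans; [apply (sol_bound k s Hk Hs)|]. pose proof (lgs_bounds x); lra. }
(* Here [G' = yh / 2 - P / 3], so the gain 7/5 is halved; 3/4 leaves room above 7/10 for terms of
   relative size [1 / k], and 4/5 above 3/4 does the same for [xh]. *)
assert (Hz : forall x, Rabs (zh x) <= 3 / 4 * W n x).
{ apply (comparison _ _ _ _ _ (3 / 4) ((k + 7) * / n) zh
    (fun x => k * (yh x / 2) + (1 + Uf s x) * Pf s x / 3) (W_admissible_fast true n Hn)); [lra| | |].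
  - intros x. unfold zh at 1. pose proof (is_derive_Pf k s Hs x) as D2.
    destruct (sol_derivatives k s Hs x) as [D1 [_ [_ [_ [D3 _]]]]].
    pose proof (is_derive_unique _ _ _ (is_derive_Sf k s Hk Hs x)) as E1.
    pose proof (is_derive_Cf k s Hk Hs x) as D4.
    auto_derive; [repeat split; eexists; eassumption|].
    rewrite (is_derive_unique (fun x : R => s Ea x) _ _ D3), (is_derive_unique (fun x : R => Pf s x) _ _ D2).
    assert (E2 : Derive (Sf s) x = ((1 + 4 * lgs x) * s Sg x + sg_rhs (lgs x) (rt x) (s Sg x) (s Pi x) (s Hh x) (s Ea x) (s Eb x)) + 4 / 3 * Pf s x).
    { apply is_derive_unique. unfold Sf. auto_derive; [repeat split; eexists; eassumption|].
      rewrite (is_derive_unique (fun x : R => s Sg x) _ _ D1), (is_derive_unique (fun x : R => Cf s x) _ _ D4). ring. }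
    fold (Yf s x) in E1. rewrite E1 in E2. unfold zh, yh. rewrite E2. simpl. field.
  - intros x; specialize (Hy x); specialize (HUP x); destruct (W_facts n x Hn) as [[HW _] _].
    assert (Hky : Rabs (k * (yh x / 2)) <= k * (7 / 10 * W n x)).
    { rewrite Rabs_mult, (Rabs_right k) by lra. apply Rmult_le_compat_l; [lra|].
      absb; apply Rabs_le; lra. }
    eapply Rle_trans; [apply Rabs_triang|].
    assert (1000 * W n x <= k * W n x) by (apply Rmult_le_compat_r; lra). lra.
  - intros x; eapply Rle_trans; [|apply Hbig].
    destruct (sol_estimates k s Hk Hs x) as [_ [_ [_ [_ [HP _]]]]].
    pose proof (Pf_pos k s Hk Hs x); pose proof (lgs_bounds x).
    specialize (He Ea x ltac:(unfold row_W; lra)). unfold zh. absb; apply Rabs_le; lra. }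
split; [exact Hy|split; [exact Hz|]].
apply (comparison _ _ _ _ _ (4 / 5) ((k + 7) * / n) xh
  (fun x => k * zh x - (1 + Uf s x) * Pf s x / 3) (W_admissible_fast false n Hn)); [lra| | |].
- intros x. unfold xh at 1. pose proof (is_derive_Pf k s Hs x) as D2.
  destruct (sol_derivatives k s Hs x) as [_ [_ [_ [_ [_ D3]]]]].
  auto_derive; [repeat split; eexists; eassumption|].
  rewrite (is_derive_unique (fun x : R => s Eb x) _ _ D3), (is_derive_unique (fun x : R => Pf s x) _ _ D2).
  unfold xh, zh. simpl. field.
- intros x; specialize (Hz x); specialize (HUP x); destruct (W_facts n x Hn) as [[HW _] _].
  assert (Hkz : Rabs (k * zh x) <= k * (3 / 4 * W n x)).
  { rewrite Rabs_mult, (Rabs_right k) by lra. apply Rmult_le_compat_l; lra. }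
  unfold Rminus; eapply Rle_trans; [apply Rabs_triang|]. rewrite Rabs_Ropp.
  assert (1000 * W n x <= k * W n x) by (apply Rmult_le_compat_r; lra). lra.
- intros x; eapply Rle_trans; [|apply Hbig].
  destruct (sol_estimates k s Hk Hs x) as [_ [_ [_ [_ [HP _]]]]].
  pose proof (Pf_pos k s Hk Hs x); pose proof (lgs_bounds x).
  specialize (He Eb x ltac:(unfold row_W; lra)). unfold xh. absb; apply Rabs_le; lra.
Qed.

(** The start [n = k + 7] covers the crude bound from the contraction. One step multiplies [W n] by
    4/5; the part [P / 5] is enlarged back to [P / 4], and only [n] shrinks. *)
Lemma xh_bound j : forall x, Rabs (xh x) <= W ((k + 7) * (4 / 5) ^ j) x.
Proof.
assert (Hk' := Hk); unfold k0 in Hk'.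
induction j as [|j IH]; intros x.
- destruct (sol_estimates k s Hk Hs x) as [_ [_ [_ [_ [HP _]]]]].
  pose proof (Pf_pos k s Hk Hs x); pose proof (lgs_bounds x).
  pose proof (sol_bound k s Hk Hs Eb x) as b; unfold row_W in b.
  assert (Rabs (k * s Eb x) <= k * lgs x).
  { rewrite Rabs_mult, (Rabs_right k) by lra. apply Rmult_le_compat_l; lra. }
  unfold xh, W; simpl. absb; apply Rabs_le; lra.
- assert (Hj : 0 < (4 / 5) ^ j) by (apply pow_lt; lra).
  destruct (comparison_step _ (Rmult_lt_0_compat (k + 7) _ ltac:(lra) Hj) IH) as [_ [_ H]].
  eapply Rle_trans; [apply H|]. pose proof (Pf_pos k s Hk Hs x). unfold W; simpl. lra.
Qed.

(** The limit [n -> 0]. It yields the sign of [q] ([- U' >= P / 12]), the monotonicity of [S], and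
    the domination of [k Ea] and [k Eb] by [C']. *)
Lemma slope_ratios x :
  Rabs (- k * s Eb x - Pf s x / 3) <= Pf s x / 4 /\
  Rabs (Yf s x - 4 / 3 * Pf s x) <= 7 / 20 * Pf s x /\
  Rabs (- k * s Ea x + Pf s x / 3) <= 3 / 16 * Pf s x.
Proof.
assert (Hk' := Hk); unfold k0 in Hk'.
assert (Hj : forall j, 0 < (4 / 5) ^ j) by (intros; apply pow_lt; lra).
pose proof (fun j => comparison_step _ (Rmult_lt_0_compat (k + 7) _ ltac:(lra) (Hj j)) (xh_bound j)) as H.
split; [|split].
- apply (Rabs_le_geometric _ _ ((k + 7) * lgs x) (4 / 5)); [lra|]; intros j.
  pose proof (xh_bound j x) as B; unfold xh, W in B. lra.
- apply (Rabs_le_geometric _ _ (7 / 5 * (k + 7) * lgs x) (4 / 5)); [lra|]; intros j.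
  destruct (H j) as [B _]; specialize (B x); unfold yh, W in B. lra.
- apply (Rabs_le_geometric _ _ (3 / 4 * (k + 7) * lgs x) (4 / 5)); [lra|]; intros j.
  destruct (H j) as [_ [B _]]; specialize (B x); unfold zh, W in B. lra.
Qed.
End Monotonicity.

(** * Limits and end states *)

Lemma is_lim_lgs_p : is_lim lgs p_infty 1.
Proof.
apply (is_lim_ext (fun x => 1 - rt x * rt x)); [intros; symmetry; apply lgs_rt|].
replace (Finite 1) with (Finite (1 - 0 * 0)) by (f_equal; ring).
apply is_lim_minus'; [apply is_lim_const|].
apply (is_lim_mult rt rt p_infty 0 0); simpl; auto using is_lim_rt_p.
Qed.

Lemma is_lim_dist_le (f g : R -> R) (e : Rbar) (l l' M : R) :
  is_lim f e l -> is_lim g e l' -> (forall x, Rabs (f x - g x) <= M) -> Rabs (l - l') <= M.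
Proof.
intros Hf Hg HM.
assert (H1 : Rbar_le (l - l') M).
{ apply (is_lim_le_loc (fun x => f x - g x) (fun _ => M) e).
  - apply filter_forall; intros x; specialize (HM x); absb; lra.
  - now apply is_lim_minus'.
  - apply is_lim_const. }
assert (H2 : Rbar_le (- M) (l - l')).
{ apply (is_lim_le_loc (fun _ => - M) (fun x => f x - g x) e).
  - apply filter_forall; intros x; specialize (HM x); absb; lra.
  - apply is_lim_const.
  - now apply is_lim_minus'. }
simpl in H1, H2; apply Rabs_le; lra.
Qed.

Lemma sol_limits_m (k : R) s : k0 <= k -> is_sol k s ->
  is_lim (Cf s) m_infty 0 /\ is_lim (Sf s) m_infty 0 /\ is_lim (Uf s) m_infty 0 /\
  is_lim (s Eb) m_infty 0.
Proof.
intros Hk Hs.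
assert (H : forall f : R -> R, (forall x, Rabs (f x) <= 9 * lgs x) -> is_lim f m_infty 0).
{ intros f Hf; apply (Rabs_le_lim_0 f (fun x => 9 * lgs x)); [exact Hf|].
  apply is_lim_scal0, is_lim_lgs_m. }
repeat match goal with |- _ /\ _ => split end; apply H; intros x;
  destruct (sol_estimates k s Hk Hs x) as [H1 [_ [H3 [H4 _]]]];
  pose proof (lgs_bounds x); try exact H4;
  pose proof (sol_bound k s Hk Hs Eb x) as H5; unfold row_W in H5; absb; apply Rabs_le; lra.
Qed.

(** The weights of [Ea] and [Eb] do not vanish at plus infinity, so the contraction alone gives no
    limits there. [C] and [S] converge as bounded increasing functions, and [Ea], [Eb] vanish
    because they are dominated by [C' <= 7 t]. *)
Lemma sol_limits_p (k : R) s : k0 <= k -> is_sol k s ->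
  exists c d : R, is_lim (Cf s) p_infty c /\ is_lim (Sf s) p_infty d /\
    is_lim (Uf s) p_infty (d / 2 - c) /\ is_lim (s Eb) p_infty 0.
Proof.
intros Hk Hs. assert (Hk' := Hk); unfold k0 in Hk'.
pose proof (slope_ratios k s Hk Hs) as HR.
pose proof (Pf_pos k s Hk Hs) as HP.
destruct (is_lim_monotone_p (Cf s) 7) as [c Hc].
{ apply (derive_nonneg_le (Cf s) (Pf s)); [now apply (is_derive_Cf k)|].
  intros x; left; apply HP. }
{ intros x; destruct (sol_estimates k s Hk Hs x) as [_ [_ [H _]]].
  pose proof (lgs_bounds x); absb; lra. }
destruct (is_lim_monotone_p (Sf s) 9) as [d Hd].
{ apply (derive_nonneg_le (Sf s) (Yf s)); [now apply (is_derive_Sf k)|].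
  intros x; destruct (HR x) as [_ [H _]]; specialize (HP x); absb; lra. }
{ intros x; destruct (sol_estimates k s Hk Hs x) as [_ [_ [_ [H _]]]].
  pose proof (lgs_bounds x); absb; lra. }
assert (H7 : is_lim (fun x => 7 * rt x) p_infty 0) by apply is_lim_scal0, is_lim_rt_p.
assert (Hsm : forall e x, Rabs (k * e) <= Pf s x -> Rabs e <= 7 * rt x).
{ intros e x He. destruct (sol_estimates k s Hk Hs x) as [_ [_ [_ [_ [_ H]]]]].
  rewrite Rabs_mult, (Rabs_right k) in He by lra. pose proof (Rabs_pos e). nra. }
assert (Ha : is_lim (s Ea) p_infty 0).
{ apply (Rabs_le_lim_0 _ _ _ (fun x => Hsm (s Ea x) x ltac:(
    destruct (HR x) as [_ [_ H]]; specialize (HP x); absb; apply Rabs_le; lra)) H7). }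
assert (Hb : is_lim (s Eb) p_infty 0).
{ apply (Rabs_le_lim_0 _ _ _ (fun x => Hsm (s Eb x) x ltac:(
    destruct (HR x) as [H _]; specialize (HP x); absb; apply Rabs_le; lra)) H7). }
exists c, d; split; [exact Hc|split; [exact Hd|split; [|exact Hb]]].
apply (is_lim_ext (fun x => (/ 2 * Sf s x - Cf s x) + (s Ea x + s Eb x))).
{ intros; unfold Uf, Sf; field. }
replace (Finite (d / 2 - c)) with (Finite ((/ 2 * d - c) + (0 + 0))) by (f_equal; field).
apply is_lim_plus'; [|now apply is_lim_plus'].
apply is_lim_minus'; [|exact Hc]. now apply (is_lim_scal_l _ (/ 2) _ (Finite d)).
Qed.

Definition Cinf (k : R) : R := real (Lim (Cf (sol k)) p_infty).
Definition Sinf (k : R) : R := real (Lim (Sf (sol k)) p_infty).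

Lemma sol_limits (k : R) : k0 <= k ->
  is_lim (Cf (sol k)) p_infty (Cinf k) /\ is_lim (Sf (sol k)) p_infty (Sinf k) /\
  is_lim (Uf (sol k)) p_infty (Sinf k / 2 - Cinf k) /\ is_lim (sol k Eb) p_infty 0.
Proof.
intros Hk; destruct (sol_limits_p k _ Hk (sol_is_sol k Hk)) as [c [d [H1 [H2 [H3 H4]]]]].
unfold Cinf, Sinf. rewrite (is_lim_unique _ _ _ H1), (is_lim_unique _ _ _ H2); simpl. auto.
Qed.

(** The stability bound is uniform on the line, so it passes to the limit at plus infinity. *)
Lemma end_state_lipschitz (k k' : R) : k0 <= k -> k0 <= k' ->
  Rabs (Cinf k - Cinf k') <= Rabs (k - k') /\ Rabs (Sinf k - Sinf k') <= Rabs (k - k').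
Proof.
intros Hk Hk'.
pose proof (sol_stability k k' _ _ Hk Hk' (sol_is_sol k Hk) (sol_is_sol k' Hk')) as HS.
destruct (sol_limits k Hk) as [A1 [A2 _]]; destruct (sol_limits k' Hk') as [B1 [B2 _]].
assert (H : forall x, Rabs (sol k Hh x - sol k' Hh x) <= Rabs (k - k') / 500 /\
  Rabs (sol k Sg x - sol k' Sg x) <= Rabs (k - k') / 2000).
{ intros x; pose proof (lgs_bounds x) as Hw; pose proof (Rabs_pos (k - k')).
  assert (lgs x ^ 2 < 1) by (simpl; nra).
  split; (eapply Rle_trans; [apply HS|]); unfold row_W; nra. }
split.
- apply (is_lim_dist_le _ _ _ _ _ _ A1 B1); intros x; destruct (H x) as [h1 _].
  unfold Cf; pose proof (Rabs_pos (k - k')); absb; apply Rabs_le; lra.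
- apply (is_lim_dist_le _ _ _ _ _ _ A2 B2); intros x; destruct (H x) as [h1 h2].
  unfold Sf, Cf; pose proof (Rabs_pos (k - k')); absb; apply Rabs_le; lra.
Qed.

Lemma end_state_near (k : R) : k0 <= k ->
  Rabs (Cinf k - 6) <= 6000 / k /\ Rabs (Sinf k - 8) <= 6000 / k.
Proof.
intros Hk. pose proof (delta_small k Hk) as Hd.
destruct (sol_limits k Hk) as [A1 [A2 _]]; pose proof (sol_is_sol k Hk) as Hs.
assert (H : forall x, Rabs (sol k Hh x) <= 4 * (800 / k) /\ Rabs (sol k Sg x) <= 800 / k).
{ intros x; pose proof (lgs_bounds x) as Hw. assert (lgs x ^ 2 < 1) by (simpl; nra).
  split; (eapply Rle_trans; [apply Hs|]); unfold row_W; nra. }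
replace (6000 / k) with (15 / 2 * (800 / k)) by (field; unfold k0 in Hk; lra).
split.
- apply (is_lim_dist_le _ (fun x => 6 * lgs x) _ _ _ _ A1).
  + replace (Finite 6) with (Finite (6 * 1)) by (f_equal; ring).
    apply (is_lim_scal_l lgs 6 p_infty (Finite 1)), is_lim_lgs_p.
  + intros x; destruct (H x) as [h1 _]. unfold Cf; absb; apply Rabs_le; lra.
- apply (is_lim_dist_le _ (fun x => 8 * lgs x) _ _ _ _ A2).
  + replace (Finite 8) with (Finite (8 * 1)) by (f_equal; ring).
    apply (is_lim_scal_l lgs 8 p_infty (Finite 1)), is_lim_lgs_p.
  + intros x; destruct (H x) as [h1 h2]. unfold Sf, Cf; absb; apply Rabs_le; lra.
Qed.

(** * Back to the IPM equations *)

(** The wave equations in [x = y - v t] with [u2 = - u1] eliminated. Derivatives are explicit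
    witnesses, so that shift and reflection act on [is_derive] directly. *)
Definition smooth_profile (l v : R) (g1 g2 g3 g5 : R -> R) : Prop :=
  exists d1 d2 d3 d5 dd1 dd2 : R -> R, forall x,
    is_derive g1 x (d1 x) /\ is_derive g2 x (d2 x) /\ is_derive g3 x (d3 x) /\
    is_derive g5 x (d5 x) /\ is_derive d1 x (dd1 x) /\ is_derive d2 x (dd2 x) /\
    - v * d1 x + (d3 x * g1 x + g3 x * d1 x) - dd1 x = - fexch l (g1 x) (g2 x) (g5 x) /\
    - v * d2 x - (d3 x * g2 x + g3 x * d2 x) - dd2 x = fexch l (g1 x) (g2 x) (g5 x) /\
    d5 x = 2 * g3 x + g1 x - g2 x /\ d3 x = g5 x / l ^ 2.

Lemma is_derive_shift (g : R -> R) (d a x : R) :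
  is_derive g (x - a) d -> is_derive (fun z : R => g (z - a)) x d.
Proof.
intros H. apply (is_derive_eq _ _ (scal 1 d)).
- apply (is_derive_comp g (fun z : R => z - a)); [exact H|]. auto_derive; [trivial|ring].
- apply (scal_one d).
Qed.

Lemma is_derive_wave_t (g : R -> R) (d v y t : R) :
  is_derive g (y - v * t) d -> is_derive (fun s : R => g (y - v * s)) t (- v * d).
Proof.
intros H. apply (is_derive_comp g (fun s : R => y - v * s) t d (- v)); [exact H|].
auto_derive; [trivial|ring].
Qed.

Lemma profile_IPM (l v : R) g1 g2 g3 g5 : smooth_profile l v g1 g2 g3 g5 ->
  IPM_solution l (fun t y => g1 (y - v * t)) (fun t y => g2 (y - v * t))
    (fun t y => g3 (y - v * t)) (fun t y => - g3 (y - v * t)) (fun t y => g5 (y - v * t)).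
Proof.
intros [d1 [d2 [d3 [d5 [dd1 [dd2 H]]]]]] t y _.
unfold ex_dt, ex_dy, dt, dy.
set (x := y - v * t).
destruct (H x) as [D1 [D2 [D3 [D5 [DD1 [DD2 [Q1 [Q2 [Q3 Q4]]]]]]]]].
pose proof (is_derive_wave_t g1 _ v y t D1) as T1.
pose proof (is_derive_wave_t g2 _ v y t D2) as T2.
pose proof (is_derive_shift g1 _ _ _ D1) as Y1.
pose proof (is_derive_shift g2 _ _ _ D2) as Y2.
pose proof (is_derive_shift g3 _ _ _ D3) as Y3.
pose proof (is_derive_shift g5 _ _ _ D5) as Y5.
assert (Y11 : is_derive (fun z : R => Derive (fun z : R => g1 (z - v * t)) z) y (dd1 x)).
{ apply (is_derive_ext (fun z : R => d1 (z - v * t))); [|now apply is_derive_shift].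
  intros z; symmetry; apply is_derive_unique, is_derive_shift, H. }
assert (Y22 : is_derive (fun z : R => Derive (fun z : R => g2 (z - v * t)) z) y (dd2 x)).
{ apply (is_derive_ext (fun z : R => d2 (z - v * t))); [|now apply is_derive_shift].
  intros z; symmetry; apply is_derive_unique, is_derive_shift, H. }
assert (Y31 : is_derive (fun z : R => g3 (z - v * t) * g1 (z - v * t)) y (d3 x * g1 x + g3 x * d1 x)).
{ apply (is_derive_mult _ _ _ _ _ Y3 Y1). intros; apply Rmult_comm. }
assert (Y32 : is_derive (fun z : R => - g3 (z - v * t) * g2 (z - v * t)) y (- (d3 x * g2 x + g3 x * d2 x))).
{ apply (is_derive_ext (fun z : R => - (g3 (z - v * t) * g2 (z - v * t)))); [intros; simpl; ring|].
  apply (is_derive_opp (fun z : R => g3 (z - v * t) * g2 (z - v * t))).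
  apply (is_derive_mult _ _ _ _ _ Y3 Y2). intros; apply Rmult_comm. }
rewrite (is_derive_unique _ _ _ T1), (is_derive_unique _ _ _ T2), (is_derive_unique _ _ _ Y11),
  (is_derive_unique _ _ _ Y22), (is_derive_unique _ _ _ Y31), (is_derive_unique _ _ _ Y32),
  (is_derive_unique _ _ _ Y5), (is_derive_unique _ _ _ Y3).
refine (conj (ex_intro _ _ T1) (conj (ex_intro _ _ T2) (conj (ex_intro _ _ Y1) (conj (ex_intro _ _ Y2)
  (conj (ex_intro _ _ Y11) (conj (ex_intro _ _ Y22) (conj (ex_intro _ _ Y31) (conj (ex_intro _ _ Y32)
  (conj (ex_intro _ _ Y5) (conj (ex_intro _ _ Y3) _)))))))))).
fold x; repeat split; lra.
Qed.

Lemma profile_wave (l v : R) g1 g2 g3 g5 (a1 a2 a3 a5 b1 b2 b3 b5 : R) :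
  smooth_profile l v g1 g2 g3 g5 ->
  is_lim g1 m_infty a1 -> is_lim g2 m_infty a2 -> is_lim g3 m_infty a3 -> is_lim g5 m_infty a5 ->
  is_lim g1 p_infty b1 -> is_lim g2 p_infty b2 -> is_lim g3 p_infty b3 -> is_lim g5 p_infty b5 ->
  traveling_wave l v a1 a2 a3 (- a3) a5 b1 b2 b3 (- b3) b5.
Proof.
intros Hp; intros. exists g1, g2, g3, (fun x => - g3 x), g5.
pose proof (profile_IPM l v g1 g2 g3 g5 Hp) as HI.
destruct Hp as [d1 [d2 [d3 [d5 [dd1 [dd2 Hd]]]]]].
assert (Hc : forall x, continuous g1 x /\ continuous g2 x /\ continuous g3 x /\ continuous g5 x).
{ intros x; destruct (Hd x) as [D1 [D2 [D3 [D5 _]]]].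
  refine (conj _ (conj _ (conj _ _))); eapply is_derive_continuous; [exact D1|exact D2|exact D3|exact D5]. }
repeat match goal with |- _ /\ _ => split end; try assumption; try (intros x; apply (Hc x)).
- intros x; apply (continuous_opp g3), (Hc x).
- now apply (is_lim_opp g3 m_infty a3).
- now apply (is_lim_opp g3 p_infty b3).
Qed.

(** The reflection reverses the sign of [u_T] and thereby swaps the two branches; where [u_T = 0]
    both sides vanish. *)
Lemma fexch_reflect (l c1 c2 q : R) : fexch l (- c2) (- c1) (- q) = fexch l c1 c2 q.
Proof.
unfold fexch, uT. replace (- - q / l) with (- (- q / l)) by (unfold Rdiv; ring).
set (z := - q / l). destruct (Rle_dec 0 (- z)), (Rle_dec 0 z).
- replace z with 0 by lra. unfold Rdiv; ring.
- unfold Rdiv; ring.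
- unfold Rdiv; ring.
- lra.
Qed.

Lemma is_derive_reflect (f : R -> R) (x d : R) :
  is_derive f (- x) d -> is_derive (fun z => f (- z)) x (- d).
Proof.
intros H. apply (is_derive_eq _ _ (scal (- 1) d)).
- apply (is_derive_comp f Ropp x d (- 1)); [exact H|]. auto_derive; [trivial|ring].
- unfold scal; simpl; unfold mult; simpl; ring.
Qed.

Lemma smooth_profile_reflect (l v : R) g1 g2 g3 g5 : smooth_profile l v g1 g2 g3 g5 ->
  smooth_profile l (- v) (fun x => - g2 (- x)) (fun x => - g1 (- x)) (fun x => g3 (- x))
    (fun x => - g5 (- x)).
Proof.
intros [d1 [d2 [d3 [d5 [dd1 [dd2 H]]]]]].
assert (Hopp : forall (f : R -> R) x d, is_derive f (- x) d -> is_derive (fun z => - f (- z)) x d).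
{ intros f x d Hf; apply (is_derive_eq _ _ (opp (- d))).
  - now apply (is_derive_opp (fun z => f (- z))), is_derive_reflect.
  - unfold opp; simpl; ring. }
exists (fun x => d2 (- x)), (fun x => d1 (- x)), (fun x => - d3 (- x)), (fun x => d5 (- x)),
  (fun x => - dd2 (- x)), (fun x => - dd1 (- x)).
intros x; destruct (H (- x)) as [D1 [D2 [D3 [D5 [DD1 [DD2 [Q1 [Q2 [Q3 Q4]]]]]]]]].
rewrite fexch_reflect.
refine (conj (Hopp _ _ _ D2) (conj (Hopp _ _ _ D1) (conj (is_derive_reflect _ _ _ D3)
  (conj (Hopp _ _ _ D5) (conj (is_derive_reflect _ _ _ DD2) (conj (is_derive_reflect _ _ _ DD1) _)))))).
repeat split; [lra..|]. rewrite Q4; unfold Rdiv; ring.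
Qed.

Lemma is_lim_reflect_m (f : R -> R) (l : Rbar) : is_lim f p_infty l -> is_lim (fun x => f (- x)) m_infty l.
Proof.
intros H; apply is_lim_opp_p_m. apply (is_lim_ext f); [intros; f_equal; ring|exact H].
Qed.

Lemma is_lim_reflect_p (f : R -> R) (l : Rbar) : is_lim f m_infty l -> is_lim (fun x => f (- x)) p_infty l.
Proof.
intros H; apply is_lim_opp_m_p. apply (is_lim_ext f); [intros; f_equal; ring|exact H].
Qed.

(** * The waves of parts (A) and (B) *)

Definition kap (v l : R) : R := sqrt 2 / (l * - v).
Definition c1A (v l : R) : R := -1 + - v * Cinf (kap v l).
Definition c2A (v l : R) : R := -1 + - v * (Sinf (kap v l) - Cinf (kap v l)).

Definition g1A (v l x : R) : R := -1 + - v * Cf (sol (kap v l)) (- v * x).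
Definition g2A (v l x : R) : R :=
  -1 + - v * (Sf (sol (kap v l)) (- v * x) - Cf (sol (kap v l)) (- v * x)).
Definition g3A (v l x : R) : R := - v * Uf (sol (kap v l)) (- v * x).
(** This is [q = l^2 u1'], since [U' = kappa Eb] and [u1 = V U (V x)]. *)
Definition g5A (v l x : R) : R := (l * v) ^ 2 * kap v l * sol (kap v l) Eb (- v * x).

Lemma profile_A (v l : R) : v < 0 -> 0 < l -> k0 <= kap v l ->
  smooth_profile l v (g1A v l) (g2A v l) (g3A v l) (g5A v l).
Proof.
intros Hv Hl Hk.
assert (Hlv : 0 < l * - v) by nra.
assert (Hkk : kap v l * kap v l = 2 / (l * v) ^ 2).
{ unfold kap. replace (sqrt 2 / (l * - v) * (sqrt 2 / (l * - v)))
   with (sqrt 2 * sqrt 2 / (l * v) ^ 2) by (field; lra).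
  rewrite sqrt_sqrt; lra. }
pose proof (sol_is_sol _ Hk) as Hs.
unfold g1A, g2A, g3A, g5A. set (k := kap v l) in *. set (s := sol k) in *.
clearbody s k.
exists (fun x => v ^ 2 * Pf s (- v * x)), (fun x => v ^ 2 * (Yf s (- v * x) - Pf s (- v * x))),
  (fun x => v ^ 2 * (k * s Eb (- v * x))),
  (fun x => (l * v) ^ 2 * k * (- v * (k * s Eb (- v * x) + k * s Ea (- v * x)))),
  (fun x => - v ^ 3 * ((1 + Uf s (- v * x)) * Pf s (- v * x))),
  (fun x => - v ^ 3 * (((1 - Uf s (- v * x)) * Yf s (- v * x)
     + k * s Eb (- v * x) * (2 * Cf s (- v * x) - Sf s (- v * x))
     + 2 * Uf s (- v * x) * Pf s (- v * x)) - (1 + Uf s (- v * x)) * Pf s (- v * x))).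
intros x.
pose proof (is_derive_Cf k s Hk Hs (- v * x)) as DC.
pose proof (is_derive_Pf k s Hs (- v * x)) as DP.
pose proof (is_derive_Sf k s Hk Hs (- v * x)) as DS.
pose proof (is_derive_Uf k s Hk Hs (- v * x)) as DU.
pose proof (is_derive_Yf k s Hk Hs (- v * x)) as DY.
destruct (sol_derivatives k s Hs (- v * x)) as [_ [_ [_ [_ [_ De]]]]].
fold (Yf s (- v * x)) in DS.
(* The sign of [q] selects the branch of the exchange term with [c1]. That branch equals [- u1' c1],
   which cancels the term [u1' c1] of the transport. *)
assert (Hneg : 0 <= uT l ((l * v) ^ 2 * k * s Eb (- v * x))).
{ destruct (slope_ratios k s Hk Hs (- v * x)) as [HR _].
  pose proof (Pf_pos k s Hk Hs (- v * x)).
  unfold uT. apply Rmult_le_pos; [|left; now apply Rinv_0_lt_compat].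
  assert (0 <= - k * s Eb (- v * x)) by (absb; lra).
  assert (0 < (l * v) ^ 2) by (simpl; nra). nra. }
assert (Hf : fexch l (-1 + - v * Cf s (- v * x)) (-1 + - v * (Sf s (- v * x) - Cf s (- v * x)))
    ((l * v) ^ 2 * k * s Eb (- v * x))
  = - v ^ 2 * (k * s Eb (- v * x)) * (-1 + - v * Cf s (- v * x))).
{ unfold fexch. destruct (Rle_dec _ _) as [_|N]; [|contradiction]. unfold uT. field; lra. }
rewrite Hf.
set (C := Cf s) in *; set (S := Sf s) in *; set (U := Uf s) in *; set (Y := Yf s) in *;
set (P := Pf s) in *; set (e := s Eb) in *.
assert (HU : U (- v * x) = S (- v * x) / 2 - C (- v * x) + (s Ea (- v * x) + e (- v * x)))
  by (unfold U, S, C, e, Uf, Sf; field).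
clearbody C S U Y P e.
repeat match goal with |- _ /\ _ => split end.
- auto_derive; [repeat split; eexists; eassumption|].
  rewrite (is_derive_unique (fun x : R => C x) _ _ DC). ring.
- auto_derive; [repeat split; eexists; eassumption|].
  rewrite (is_derive_unique (fun x : R => C x) _ _ DC), (is_derive_unique (fun x : R => S x) _ _ DS). ring.
- auto_derive; [repeat split; eexists; eassumption|].
  rewrite (is_derive_unique (fun x : R => U x) _ _ DU). ring.
- auto_derive; [repeat split; eexists; eassumption|].
  rewrite (is_derive_unique (fun x : R => e x) _ _ De). ring.
- auto_derive; [repeat split; eexists; eassumption|].
  rewrite (is_derive_unique (fun x : R => P x) _ _ DP). ring.
- auto_derive; [repeat split; eexists; eassumption|].
  rewrite (is_derive_unique (fun x : R => P x) _ _ DP), (is_derive_unique (fun x : R => Y x) _ _ DY). ring.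
- ring.
- ring.
(* Here [kappa^2 = 2 / (l v)^2] enters: both sides equal [2 V (U - G)], with [U - G = Ea + Eb]. *)
- replace ((l * v) ^ 2 * k * (- v * (k * e (- v * x) + k * s Ea (- v * x))))
    with (- v * ((l * v) ^ 2 * (k * k)) * (e (- v * x) + s Ea (- v * x))) by ring.
  rewrite Hkk, HU. field. lra.
- field. lra.
Qed.

Lemma is_lim_dilate (f : R -> R) (c : R) (fwd : bool) (L : Rbar) : 0 < c ->
  is_lim f (tail fwd) L -> is_lim (fun x => f (c * x)) (tail fwd) L.
Proof.
intros Hc H. apply (is_lim_comp f (fun x => c * x) (tail fwd) L (tail fwd)); [exact H| |].
- apply is_lim_spec; destruct fwd; intros M; exists (M / c); intros x Hx;
    apply (Rmult_lt_compat_l c) in Hx; try lra;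
    replace (c * (M / c)) with M in Hx by (field; lra); exact Hx.
- destruct fwd; exists 0; intros; discriminate.
Qed.

Lemma is_lim_affine (f : R -> R) (a b L : R) (e : Rbar) :
  is_lim f e L -> is_lim (fun x => a + b * f x) e (a + b * L).
Proof.
intros H. apply (is_lim_plus' (fun _ => a) (fun x => b * f x)); [apply is_lim_const|].
now apply (is_lim_scal_l f b e (Finite L)).
Qed.

Lemma profile_A_limits (v l : R) : v < 0 -> k0 <= kap v l ->
  is_lim (g1A v l) m_infty (-1) /\ is_lim (g2A v l) m_infty (-1) /\
  is_lim (g3A v l) m_infty 0 /\ is_lim (g5A v l) m_infty 0 /\
  is_lim (g1A v l) p_infty (c1A v l) /\ is_lim (g2A v l) p_infty (c2A v l) /\
  is_lim (g3A v l) p_infty ((c2A v l - c1A v l) / 2) /\ is_lim (g5A v l) p_infty 0.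
Proof.
intros Hv Hk.
assert (A : forall (f : R -> R) (a b L L' : R) fwd, is_lim f (tail fwd) L -> L' = a + b * L ->
  is_lim (fun x => a + b * f (- v * x)) (tail fwd) L').
{ intros f a b L L' fwd Hf ->. apply (is_lim_affine (fun x => f (- v * x))).
  apply is_lim_dilate; [lra|exact Hf]. }
assert (A0 : forall (f : R -> R) (b L L' : R) fwd, is_lim f (tail fwd) L -> L' = b * L ->
  is_lim (fun x => b * f (- v * x)) (tail fwd) L').
{ intros f b L L' fwd Hf E. apply (is_lim_ext (fun x => 0 + b * f (- v * x))); [intros; ring|].
  apply A with L; [exact Hf|lra]. }
destruct (sol_limits_m _ _ Hk (sol_is_sol _ Hk)) as [M1 [M2 [M3 M4]]].
destruct (sol_limits _ Hk) as [P1 [P2 [P3 P4]]].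
pose proof (is_lim_minus' _ _ _ _ _ M2 M1) as M21.
pose proof (is_lim_minus' _ _ _ _ _ P2 P1) as P21.
unfold g1A, g2A, g3A, g5A, c1A, c2A.
refine (conj _ (conj _ (conj _ (conj _ (conj _ (conj _ (conj _ _))))))).
- apply (A (Cf (sol (kap v l))) _ _ _ _ true M1); ring.
- apply (A _ _ _ _ _ true M21); ring.
- apply (A0 _ _ _ _ true M3); ring.
- apply (A0 _ _ _ _ true M4); ring.
- apply (A (Cf (sol (kap v l))) _ _ _ _ false P1); ring.
- apply (A _ _ _ _ _ false P21); ring.
- apply (A0 _ _ _ _ false P3); field.
- apply (A0 _ _ _ _ false P4); ring.
Qed.

Lemma wave_A (v l : R) : v < 0 -> 0 < l -> k0 <= kap v l ->
  traveling_wave l v (-1) (-1) 0 0 0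
    (c1A v l) (c2A v l) ((c2A v l - c1A v l) / 2) ((c1A v l - c2A v l) / 2) 0.
Proof.
intros Hv Hl Hk.
destruct (profile_A_limits v l Hv Hk) as [M1 [M2 [M3 [M5 [P1 [P2 [P3 P5]]]]]]].
pose proof (profile_wave _ _ _ _ _ _ _ _ _ _ _ _ _ _ (profile_A v l Hv Hl Hk) M1 M2 M3 M5 P1 P2 P3 P5) as H.
replace ((c1A v l - c2A v l) / 2) with (- ((c2A v l - c1A v l) / 2)) by field.
now rewrite Ropp_0 in H.
Qed.

Lemma wave_B (v l : R) : 0 < v -> 0 < l -> k0 <= kap (- v) l ->
  traveling_wave l v (- c2A (- v) l) (- c1A (- v) l)
    ((- c1A (- v) l - - c2A (- v) l) / 2) ((- c2A (- v) l - - c1A (- v) l) / 2) 0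
    1 1 0 0 0.
Proof.
intros Hv Hl Hk.
destruct (profile_A_limits (- v) l ltac:(lra) Hk) as [M1 [M2 [M3 [M5 [P1 [P2 [P3 P5]]]]]]].
pose proof (smooth_profile_reflect _ _ _ _ _ _ (profile_A (- v) l ltac:(lra) Hl Hk)) as HR.
rewrite Ropp_involutive in HR.
assert (RM : forall (f : R -> R) (L : R), is_lim f p_infty L -> is_lim (fun x => - f (- x)) m_infty (- L)).
{ intros f L H; now apply (is_lim_opp (fun x => f (- x)) m_infty L), is_lim_reflect_m. }
assert (RP : forall (f : R -> R) (L : R), is_lim f m_infty L -> is_lim (fun x => - f (- x)) p_infty (- L)).
{ intros f L H; now apply (is_lim_opp (fun x => f (- x)) p_infty L), is_lim_reflect_p. }
pose proof (profile_wave _ _ _ _ _ _ _ _ _ _ _ _ _ _ HR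
  (RM _ _ P2) (RM _ _ P1) (is_lim_reflect_m _ _ P3) (RM _ _ P5)
  (RP _ _ M2) (RP _ _ M1) (is_lim_reflect_p _ _ M3) (RP _ _ M5)) as H.
rewrite Ropp_0 in H.
replace ((- c1A (- v) l - - c2A (- v) l) / 2) with ((c2A (- v) l - c1A (- v) l) / 2) by field.
replace ((- c2A (- v) l - - c1A (- v) l) / 2) with (- ((c2A (- v) l - c1A (- v) l) / 2)) by field.
now replace (- -1) with 1 in H by ring.
Qed.

(** * Dependence of the end states on speed and parameter *)

Lemma kap_large (v l : R) : -1/4 - 1/8 < v < -1/4 + 1/8 -> 0 < l < / k0 -> k0 < kap v l.
Proof.
intros Hv Hl. assert (H2 : 1 < sqrt 2) by (rewrite <- sqrt_1 at 1; apply sqrt_lt_1; lra).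
assert (Hk0 : 0 < k0) by (unfold k0; lra).
assert (Hlv : 0 < l * - v) by nra.
assert (Hl1 : l * k0 < 1).
{ destruct Hl as [_ Hl]. apply (Rmult_lt_compat_r k0) in Hl; [|exact Hk0].
  rewrite Rinv_l in Hl; lra. }
unfold kap. apply (Rmult_lt_reg_r (l * - v)); [exact Hlv|].
unfold Rdiv; rewrite Rmult_assoc, Rinv_l by lra. nra.
Qed.

Lemma continuous_lipschitz_above (f : R -> R) (a : R) :
  (forall x y, a <= x -> a <= y -> Rabs (f x - f y) <= Rabs (x - y)) ->
  forall x, a < x -> continuous f x.
Proof.
intros Hf x Hx. apply filterlim_locally; intros eps.
assert (Hd : 0 < Rmin eps (x - a)) by (apply Rmin_pos; [apply cond_pos|lra]).
exists (mkposreal _ Hd); intros y Hy. change (Rabs (y - x) < Rmin eps (x - a)) in Hy.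
change (Rabs (f y - f x) < eps).
pose proof (Rmin_l eps (x - a)); pose proof (Rmin_r eps (x - a)).
assert (a <= y) by (apply Rabs_def2 in Hy; lra).
specialize (Hf y x ltac:(lra) ltac:(lra)); lra.
Qed.

Lemma continuous_end_state (f : R -> R) (v l : R) : v < 0 -> 0 < l -> continuous f (kap v l) ->
  continuous (fun p : R * R => -1 + - fst p * f (kap (fst p) (snd p))) (v, l).
Proof.
intros Hv Hl Hf.
assert (C1 : continuous (fun p : R * R => - fst p) (v, l))
  by apply (continuous_opp (fun p : R * R => fst p) (v, l)), continuous_fst.
apply (continuous_plus (fun _ : R * R => -1)); [apply continuous_const|].
apply (continuous_mult (fun p : R * R => - fst p)); [exact C1|].
apply (continuous_comp (fun p : R * R => kap (fst p) (snd p)) f); [|exact Hf].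
apply (continuous_mult (fun _ : R * R => sqrt 2)); [apply continuous_const|].
apply (continuous_comp (fun p : R * R => snd p * - fst p) Rinv).
- apply (continuous_mult snd (fun p : R * R => - fst p)); [apply continuous_snd|exact C1].
- apply continuous_Rinv; simpl; nra.
Qed.

Lemma continuous_c12A (v l : R) : v < 0 -> 0 < l -> k0 < kap v l ->
  continuous (fun p : R * R => c1A (fst p) (snd p)) (v, l) /\
  continuous (fun p : R * R => c2A (fst p) (snd p)) (v, l).
Proof.
intros Hv Hl Hk.
assert (HC : continuous Cinf (kap v l)).
{ apply (continuous_lipschitz_above Cinf k0); [|exact Hk]. intros; now apply end_state_lipschitz. }
assert (HS : continuous Sinf (kap v l)).
{ apply (continuous_lipschitz_above Sinf k0); [|exact Hk]. intros; now apply end_state_lipschitz. }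
split.
- now apply (continuous_end_state Cinf).
- apply (continuous_end_state (fun k => Sinf k - Cinf k)); auto. now apply (continuous_minus Sinf Cinf).
Qed.

(** As [- v < 1 < sqrt 2], the error [12000 / kappa] is at most [12000 l]; 12000 is the sum of the
    errors 6000 of [Sinf] and [Cinf], as needed for their difference. *)
Lemma end_state_limit (f : R -> R) (L v : R) : -1/4 - 1/8 < v < -1/4 + 1/8 ->
  (forall k, k0 <= k -> Rabs (f k - L) <= 12000 / k) ->
  filterlim (fun l => -1 + - v * f (kap v l)) (at_right 0) (locally (-1 + - v * L)).
Proof.
intros Hv Hf. apply filterlim_locally; intros eps.
assert (Hk0 : 0 < / k0) by (apply Rinv_0_lt_compat; unfold k0; lra).
assert (Hd : 0 < Rmin (/ k0) (eps / 12000)).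
{ apply Rmin_pos; [exact Hk0|]. destruct eps; simpl; lra. }
exists (mkposreal _ Hd); intros l Hl Hl0.
change (Rabs (l - 0) < Rmin (/ k0) (eps / 12000)) in Hl.
change (Rabs (-1 + - v * f (kap v l) - (-1 + - v * L)) < eps).
pose proof (Rmin_l (/ k0) (eps / 12000)); pose proof (Rmin_r (/ k0) (eps / 12000)).
rewrite Rabs_right in Hl by lra.
pose proof (kap_large v l Hv ltac:(lra)) as Hk.
specialize (Hf _ (Rlt_le _ _ Hk)).
assert (H2 : 1 < sqrt 2) by (rewrite <- sqrt_1 at 1; apply sqrt_lt_1; lra).
assert (Hb : 12000 / kap v l <= 12000 * l).
{ unfold kap. replace (12000 / (sqrt 2 / (l * - v))) with (12000 * (l * (- v * / sqrt 2))) by (field; repeat split; nra).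
  assert (/ sqrt 2 < 1) by (rewrite <- Rinv_1; apply Rinv_lt_contravar; lra).
  assert (0 < / sqrt 2) by (apply Rinv_0_lt_compat; lra).
  apply Rmult_le_compat_l; [lra|]. rewrite <- (Rmult_1_r l) at 2. apply Rmult_le_compat_l; [lra|nra]. }
replace (_ - _) with (- v * (f (kap v l) - L)) by ring.
rewrite Rabs_mult, (Rabs_right (- v)) by lra.
pose proof (Rabs_pos (f (kap v l) - L)).
apply Rle_lt_trans with (1 * (12000 * l)); [apply Rmult_le_compat; lra|lra].
Qed.

Lemma limit_c12A (v : R) : -1/4 - 1/8 < v < -1/4 + 1/8 ->
  filterlim (fun l => c1A v l) (at_right 0) (locally (-6 * v - 1)) /\
  filterlim (fun l => c2A v l) (at_right 0) (locally (-2 * v - 1)).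
Proof.
intros Hv.
assert (Hp : forall k, k0 <= k -> 6000 / k <= 12000 / k).
{ intros k Hk; apply Rmult_le_compat_r; [left; apply Rinv_0_lt_compat; unfold k0 in Hk; lra|lra]. }
split.
- replace (-6 * v - 1) with (-1 + - v * 6) by ring.
  apply (end_state_limit Cinf); [exact Hv|]. intros k Hk.
  eapply Rle_trans; [apply (end_state_near k Hk)|auto].
- replace (-2 * v - 1) with (-1 + - v * 2) by ring.
  apply (end_state_limit (fun k => Sinf k - Cinf k)); [exact Hv|]. intros k Hk.
  destruct (end_state_near k Hk) as [H1 H2].
  replace (12000 / k) with (6000 / k + 6000 / k) by (field; unfold k0 in Hk; lra).
  absb; apply Rabs_le; lra.
Qed.

Lemma continuous_reflect (f : R -> R -> R) (v l : R) :
  continuous (fun p : R * R => f (fst p) (snd p)) (- v, l) ->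
  continuous (fun p : R * R => - f (- fst p) (snd p)) (v, l).
Proof.
intros H. apply (continuous_opp (fun p : R * R => f (- fst p) (snd p))).
apply (continuous_comp_2 (fun p : R * R => - fst p) snd f); [|apply continuous_snd|exact H].
apply (continuous_opp (fun p : R * R => fst p) (v, l)), continuous_fst.
Qed.
Theorem theorem4 :
  (* (A) *)
  (exists l0 delta : R, 0 < l0 /\ 0 < delta /\
   exists c1s c2s : R -> R -> R,
     (forall v l, -1/4 - delta < v < -1/4 + delta -> 0 < l < l0 ->
        continuous (fun p : R * R => c1s (fst p) (snd p)) (v, l) /\
        continuous (fun p : R * R => c2s (fst p) (snd p)) (v, l)) /\
     (forall v, -1/4 - delta < v < -1/4 + delta ->
        filterlim (fun l => c1s v l) (at_right 0) (locally (-6 * v - 1)) /\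
        filterlim (fun l => c2s v l) (at_right 0) (locally (-2 * v - 1))) /\
     (forall v l, -1/4 - delta < v < -1/4 + delta -> 0 < l < l0 ->
        traveling_wave l v (-1) (-1) 0 0 0
          (c1s v l) (c2s v l) ((c2s v l - c1s v l) / 2)
          ((c1s v l - c2s v l) / 2) 0)) /\
  (* (B) *)
  (exists l0 delta : R, 0 < l0 /\ 0 < delta /\
   exists c1s c2s : R -> R -> R,
     (forall v l, 1/4 - delta < v < 1/4 + delta -> 0 < l < l0 ->
        continuous (fun p : R * R => c1s (fst p) (snd p)) (v, l) /\
        continuous (fun p : R * R => c2s (fst p) (snd p)) (v, l)) /\
     (forall v, 1/4 - delta < v < 1/4 + delta ->
        filterlim (fun l => c1s v l) (at_right 0) (locally (-2 * v + 1)) /\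
        filterlim (fun l => c2s v l) (at_right 0) (locally (-6 * v + 1))) /\
     (forall v l, 1/4 - delta < v < 1/4 + delta -> 0 < l < l0 ->
        traveling_wave l v
          (c1s v l) (c2s v l) ((c2s v l - c1s v l) / 2)
          ((c1s v l - c2s v l) / 2) 0
          1 1 0 0 0)).
Proof.
assert (Hl0 : 0 < / k0) by (apply Rinv_0_lt_compat; unfold k0; lra).
split.
(* The radius 1/8 keeps [v] negative and [- v] below 1, so that [l < 1 / k0] suffices for every such
   speed. *)
- exists (/ k0), (1 / 8); split; [exact Hl0|split; [lra|]].
  exists c1A, c2A; split; [|split].
  + intros v l Hv Hl; apply continuous_c12A; [lra|lra|now apply kap_large].
  + exact limit_c12A.
  + intros v l Hv Hl; apply wave_A; [lra|lra|left; now apply kap_large].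
- exists (/ k0), (1 / 8); split; [exact Hl0|split; [lra|]].
  exists (fun v l => - c2A (- v) l), (fun v l => - c1A (- v) l); split; [|split].
  + intros v l Hv Hl.
    destruct (continuous_c12A (- v) l) as [H1 H2]; [lra|lra|apply kap_large; lra|].
    split; now apply continuous_reflect.
  + intros v Hv. destruct (limit_c12A (- v) ltac:(lra)) as [H1 H2]. split.
    * replace (-2 * v + 1) with (- (-2 * - v - 1)) by ring.
      apply (filterlim_comp _ _ _ _ _ _ _ _ H2), (filterlim_opp (-2 * - v - 1)).
    * replace (-6 * v + 1) with (- (-6 * - v - 1)) by ring.
      apply (filterlim_comp _ _ _ _ _ _ _ _ H1), (filterlim_opp (-6 * - v - 1)).
  + intros v l Hv Hl; apply wave_B; [lra|lra|left; apply kap_large; lra].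
Qed.
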